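(* Let $2\le p<\infty$, $p_0\in(1,p]$, and $p_1:=\frac{pp_0}{p-p_0}$ (with $p_1=\infty$ if $p_0=p$). Then there exists a constant $C=C(p)>0$, depending only on $p$, such that for every $m\in\mathbb N$, every nonempty set $G\subset\mathbb C^m$ and any choice of parameters $b>0$, $\alpha_0\in(0,1)$, $n_0\in\mathbb N$ and $m_0\in\mathbb N\cap[1,m)$, one has \[ \begin{aligned} \gamma_{p,1}(T_p(G),\|\cdot\|_{p'})\le C\Biggl[&\Bigl(bn_0+b^2\alpha_0^{1/p}+\frac{\log\frac m{m_0}}{(2^{n_0}\alpha_0)^{1/p}}\Bigr)\sup_{x\in G}\|x\|_p^p\\ &+\sup_{x\in G}\|x\|_\infty^{p-p_0}\cdot\frac{m_0^{p_0/p}\bigl[\operatorname{diam}(G,\|\cdot\|_{p_1})\bigr]^{p_0}+\bigl[\gamma_{p,p_0}(G,\|\cdot\|_{p_1})\bigr]^{p_0}}{b^{p_0-1}}\Biggr]. \end{aligned} \]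
   Context: $\|\cdot\|_r$ is the $\ell_r^m$ norm on $\mathbb C^m$, $1\le r\le\infty$; $p'=p/(p-1)$; $T_p(G):=\{(|x(1)|^p,\dots,|x(m)|^p)\colon x\in G\}$; $\operatorname{diam}(G,\|\cdot\|)=\sup_{x,y\in G}\|x-y\|$. Chaining functional: let $(\mathbf T,\varrho)$ be a metric space, $N_0:=1$, $N_n:=2^{2^n}$ for $n\ge1$. An admissible sequence of partitions of $\mathbf T$ is a sequence $\{\mathcal A_n\}_{n\ge0}$ of partitions such that $|\mathcal A_n|\le N_n$ and every element of $\mathcal A_{n+1}$ is contained in an element of $\mathcal A_n$, for all $n\ge 0$; $\mathcal A_n(x)$ is the element of $\mathcal A_n$ containing $x$. For $\alpha>0$, $1\le\beta<\infty$, \[ \gamma_{\alpha,\beta}(\mathbf T,\varrho):=\Bigl(\inf_{\{\mathcal A_n\}}\sup_{x\in\mathbf T}\sum_{n=0}^\infty\bigl[2^{n/\alpha}\operatorname{diam}(\mathcal A_n(x),\varrho)\bigr]^\beta\Bigr)^{1/\beta}, \] the infimum being over admissible sequences; for a norm, $\gamma_{\alpha,\beta}(\mathbf T,\|\cdot\|)$ uses the induced metric. *)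

(* Defs.v *)
From HB Require Import structures.
From mathcomp Require Import all_boot all_order all_algebra.
From mathcomp Require Import all_classical all_reals all_analysis.
From mathcomp Require Import complex.

Set Implicit Arguments.
Unset Strict Implicit.
Unset Printing Implicit Defensive.

Import Order.TTheory GRing.Theory Num.Theory.
Import numFieldNormedType.Exports.

Local Open Scope classical_set_scope.
Local Open Scope ring_scope.

(* Only exponents r in [1, +oo] are meant; the value at -oo is junk.
   normc is the complex modulus as an element of R. *)
Definition lnorm (R : realType) (m : nat) (r : \bar R) (x : 'rV[R[i]]_m) : R :=
  match r with
  | EFin r => (\sum_(i < m) Normc.normc (x 0 i) `^ r) `^ r^-1
  | +oo%E => \big[Num.max/0]_(i < m) Normc.normc (x 0 i)
  | -oo%E => 0
  end.

Definition ldist (R : realType) (m : nat) (r : \bar R) (x y : 'rV[R[i]]_m) : R :=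
  lnorm r (x - y).

Definition Tp (R : realType) (m : nat) (p : R) (G : set 'rV[R[i]]_m) :
    set 'rV[R[i]]_m :=
  [set (\row_(i < m) (Normc.normc (x 0 i) `^ p)%:C%C)%R | x in G].

Definition conjugate_exponent (R : realType) (p : R) : R := p / (p - 1).

Definition exponent_p1 (R : realType) (p p0 : R) : \bar R :=
  if p0 == p then +oo%E else (p * p0 / (p - p0))%:E.

(* Metrics are passed as bare functions on an ambient type, so that several of
   them can be put on the same space. *)
Definition diam (R : realType) (X : Type) (A : set X) (d : X -> X -> R) :
    \bar R :=
  ereal_sup [set (d x y)%:E | x in A & y in A].

Definition Nadm (n : nat) : nat := if n is 0%N then 1%N else (2 ^ (2 ^ n))%N.

(* A n is the n-th partition, given as the set of its (nonempty) blocks. *)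
Definition admissible (X : Type) (T : set X) (A : nat -> set (set X)) : Prop :=
  forall n : nat,
    [/\ partition (A n) id T,
        (A n #<= `I_(Nadm n))%card &
        forall B, A n.+1 B -> exists2 B', A n B' & B `<=` B'].

Local Open Scope ereal_scope.

(* The infimum over admissible sequences is computed in \bar R. *)
Definition gamma (R : realType) (X : Type) (alpha beta : R) (T : set X)
    (d : X -> X -> R) : \bar R :=
  ereal_inf
    [set ereal_sup
       [set \sum_(0 <= n <oo)
              ((2 `^ (n%:R / alpha))%R%:E * diam (pblock (A n) id x) d) `^ beta
       | x in T]
    | A in admissible T] `^ beta^-1.

(* Main.v *)
Require Import Defs.
From HB Require Import structures.
From mathcomp Require Import all_boot all_order all_algebra.
From mathcomp Require Import all_classical all_reals all_analysis.
From mathcomp Require Import complex ring lra zify.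
Import Order.TTheory GRing.Theory Num.Theory.
Import numFieldNormedType.Exports.
Local Open Scope classical_set_scope.
Local Open Scope ring_scope.

(** Label the points of [T_p(G)] level by level: while [2 ^ k] is at most a
constant times [m0] nothing is split, and a cell at a later level [k] is split
into at most [2 ^ (2 ^ k)] cells, so that its diameter drops by a factor 4 up to
an error [S k x]; the sum of [2 ^ (k / p) S k x] over [k] then bounds
[gamma_{p,1}].

For [2 ^ k >= 24 m] a grid in the whole space gives [S = 0].  For the middle
levels fix a point [c] of a cell on which the (k-2)-nd partition of [G] is
constant, and put [M = sup ||x||_p ^ p].  At most about [alpha0 2 ^ k]
coordinates satisfy [(2 |c_i|) ^ p >= M / (alpha0 2 ^ k)], and those are treated
by a grid.  For the others let [U = max(|x_i|, |c_i|) ^ p].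
- Where [U < M / (alpha0 2 ^ (k + n0))], each level costs
  [M / (2 ^ n0 alpha0) ^ (1 / p)], and there are at most [log2 (m / m0)] levels.
- Where [U >= M max(1 / alpha0, b ^ p) / 2 ^ k], one has [|x_i - c_i| >= |x_i| / 2],
  so the mass [sum U] is itself controlled by the l_{p1}-distance.
- The window in between costs [b] times the mass in it, by Hölder and
  AM-GM; a coordinate lies in the window for at most
  [n0 + O(1 + b alpha0 ^ (1 / p))] levels. *)

Set Implicit Arguments.
Unset Strict Implicit.
Unset Printing Implicit Defensive.

(** * Inequalities for real powers *)

(** A number u in [0, 1] satisfies u <= u^t when t <= 1. Applying this to x / (x + y) and y / (x +
    y), whose sum is 1, gives subadditivity. *)
Lemma powR_addl_le (R : realType) (x y t : R) : 0 <= x -> 0 <= y ->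
  0 <= t <= 1 -> (x + y) `^ t <= x `^ t + y `^ t.
Proof.
move=> x0 y0 /andP[t0 t1].
have [->|s0] := eqVneq (x + y) 0.
  have [->|tn] := eqVneq t 0; first by rewrite !powRr0; lra.
  by rewrite powR0 // addr_ge0 ?powR_ge0.
have sp : 0 < x + y by rewrite lt_neqAle eq_sym s0 addr_ge0.
have H z : 0 <= z -> z <= x + y -> z / (x + y) * (x + y) `^ t <= z `^ t.
  move=> z0 zs; have [->|zn] := eqVneq z 0; first by rewrite !mul0r powR_ge0.
  rewrite -{2}[z](divfK s0) powRM ?(ltW sp) ?divr_ge0 ?(ltW sp) //.
  rewrite ler_wpM2r ?powR_ge0 // ger1_powR // ler_pdivrMr // mul1r zs andbT.
  by rewrite divr_gt0 // lt_neqAle eq_sym zn.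
have := lerD (H x x0 _) (H y y0 _); rewrite lerDl lerDr => /(_ y0 x0).
by rewrite -mulrDl -mulrDl divff // mul1r.
Qed.

(** Young's inequality with exponents 1/t and 1/(1 - t); the endpoints, where one of these is
    infinite, are done by hand. *)
Lemma weighted_AMGM (R : realType) (x y t : R) : 0 <= x -> 0 <= y ->
  0 <= t <= 1 -> x `^ t * y `^ (1 - t) <= t * x + (1 - t) * y.
Proof.
move=> x0 y0 /andP[t0 t1].
have [->|tn0] := eqVneq t 0; first by rewrite powRr0 subr0 powRr1 //; lra.
have [->|tn1] := eqVneq t 1; first by rewrite subrr powRr0 powRr1 //; lra.
have tp : 0 < t by rewrite lt_neqAle eq_sym tn0.
have tq : 0 < 1 - t by rewrite subr_gt0 lt_neqAle tn1.
have := @conjugate_powR R (x `^ t) (y `^ (1 - t)) t^-1 (1 - t)^-1.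
rewrite !powR_ge0 !invr_gt0 !invrK -!powRrM !divff ?gt_eqF // !powRr1 //.
by move=> /(_ isT isT tp tq) H; rewrite (mulrC t) (mulrC (1 - t)); apply: H; lra.
Qed.

(** Hölder with exponents 1/t and 1/(1 - t): normalise both sums to 1 and apply AM-GM term by term.
    As 0^0 = 1, the endpoints of t are separated before the cases of a vanishing sum. *)
Lemma hoelder_sum (R : realType) (I : finType) (J : {set I}) (f g : I -> R)
    (t : R) :
  (forall i, 0 <= f i) -> (forall i, 0 <= g i) -> 0 <= t <= 1 ->
  \sum_(i in J) f i `^ t * g i `^ (1 - t) <=
  (\sum_(i in J) f i) `^ t * (\sum_(i in J) g i) `^ (1 - t).
Proof.
move=> f0 g0 t01; have /andP[t0 t1] := t01.
have [->|tn0] := eqVneq t 0.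
  rewrite powRr0 mul1r subr0 powRr1 ?sumr_ge0 //.
  by apply: ler_sum => i _; rewrite powRr0 mul1r powRr1.
have [->|tn1] := eqVneq t 1.
  rewrite subrr powRr0 mulr1 powRr1 ?sumr_ge0 //.
  by apply: ler_sum => i _; rewrite powRr0 mulr1 powRr1.
have tn1' : 1 - t != 0 by rewrite subr_eq0 eq_sym.
set F := \sum_(i in J) f i; set G := \sum_(i in J) g i.
have F0 : 0 <= F by apply: sumr_ge0.
have G0 : 0 <= G by apply: sumr_ge0.
have [Fe|Fn] := eqVneq F 0.
  rewrite big1 ?mulr_ge0 ?powR_ge0 // => i iJ.
  rewrite (_ : f i = 0); last exact: (psumr_eq0P (fun i _ => f0 i) Fe).
  by rewrite powR0 // mul0r.
have [Ge|Gn] := eqVneq G 0.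
  rewrite big1 ?mulr_ge0 ?powR_ge0 // => i iJ.
  rewrite (_ : g i = 0); last exact: (psumr_eq0P (fun i _ => g0 i) Ge).
  by rewrite powR0 // mulr0.
have Fp : 0 < F by rewrite lt_neqAle eq_sym Fn.
have Gp : 0 < G by rewrite lt_neqAle eq_sym Gn.
have E i : f i `^ t * g i `^ (1 - t) =
    F `^ t * G `^ (1 - t) * ((f i / F) `^ t * (g i / G) `^ (1 - t)).
  have fF : 0 <= f i / F by rewrite divr_ge0.
  have gG : 0 <= g i / G by rewrite divr_ge0.
  rewrite -{1}[f i](divfK Fn) -{1}[g i](divfK Gn).
  by rewrite (powRM _ fF F0) (powRM _ gG G0); ring.
rewrite (eq_bigr _ (fun i _ => E i)).
rewrite -mulr_sumr ler_piMr ?mulr_ge0 ?powR_ge0 //.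
apply: le_trans (_ : \sum_(i in J) (t * (f i / F) + (1 - t) * (g i / G)) <= _).
  by apply: ler_sum => i _; rewrite weighted_AMGM // divr_ge0.
rewrite big_split /= -!mulr_sumr -!mulr_suml -/F -/G !divff //; lra.
Qed.

(** A mean value bound obtained without derivatives: for y <= x, AM-GM gives p y x^(p-1) <= y^p + (p
    - 1) x^p, which rearranges to the claim. *)
Lemma powR_sub_le (R : realType) (p x y a : R) : 1 <= p -> 0 <= x -> 0 <= y ->
  `|x - y| <= a ->
  `|x `^ p - y `^ p| <= p * (a * (Num.max x y) `^ (p - 1)).
Proof.
move=> p1; wlog yx : x y / y <= x => [hw|] x0 y0 xya.
  case/orP: (le_total y x) => [yx|xy]; first exact: hw.
  by rewrite distrC maxC; apply: hw => //; rewrite distrC.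
have pp : 0 < p by lra.
rewrite (max_idPl yx) ger0_norm ?subr_ge0 ?ge0_ler_powR ?nnegrE ?(ltW pp) //.
have H : p * (y * x `^ (p - 1)) <= y `^ p + (p - 1) * x `^ p.
  have := @weighted_AMGM R (y `^ p) (x `^ p) p^-1.
  rewrite !powR_ge0 invr_ge0 (ltW pp) invf_le1 // p1 => /(_ isT isT isT).
  rewrite -!powRrM divff ?gt_eqF // powRr1 //.
  have -> : p * (1 - p^-1) = p - 1 by field; lra.
  move=> h; apply: le_trans (ler_wpM2l (ltW pp) h) _.
  by rewrite le_eqVlt; apply/orP; left; apply/eqP; field; lra.
apply: le_trans (_ : p * ((x - y) * x `^ (p - 1)) <= _).
  move: H; rewrite -(mulr_powRB1 x0 pp).
  by nra.
rewrite ler_pM2l // ler_wpM2r ?powR_ge0 //.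
by apply: le_trans xya; exact: ler_norm.
Qed.

(** * Splitting a set into few classes *)

Lemma sum_geom2_lt (S : nat) : (\sum_(j < S.+1) 2 ^ (S - j) < 2 ^ S.+1)%N.
Proof.
elim: S => [|S IH]; first by rewrite big_ord1.
rewrite big_ord_recl /= subn0 [X in (_ < X)%N]expnS mul2n -addnn ltn_add2l.
apply: leq_ltn_trans IH; rewrite leq_eqVlt; apply/orP; left; apply/eqP.
by apply: eq_bigr => j _; rewrite subSS.
Qed.

(* Give [f] the weight [prod_(i in J) 2 ^ (S - f i)], which is at least
   [2 ^ (#|J| S - S)] on the set that is counted; the weights of all functions
   supported in [J] add up to [(sum_(j <= S) 2 ^ (S - j)) ^ #|J|]. *)
Lemma card_ffun_sum_le (I : finType) (J : {set I}) (S : nat) :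
  (#|[set f : {ffun I -> 'I_S.+1} |
      [forall i, (i \in J) || (f i == ord0)]
      && (\sum_(i in J) f i <= S)%N]%SET| <= 2 ^ (S + #|J|))%N.
Proof.
set A := finset _.
have [J0|Jn] := posnP #|J|.
  rewrite J0 addn0; apply: (@leq_trans 1); last by rewrite expn_gt0.
  rewrite (leq_trans (subset_leq_card (_ : A \subset [set [ffun => ord0]]%SET))) ?cards1 //.
  apply/fintype.subsetP => f; rewrite !inE => /andP[/forallP Hf _].
  apply/eqP/ffunP => i; rewrite ffunE; have := Hf i.
  by rewrite (cards0_eq J0) finset.in_set0 => /eqP.
pose w (i : I) (j : 'I_S.+1) := if i \in J then (2 ^ (S - j))%N else 1%N.
pose Q (i : I) (j : 'I_S.+1) := (i \in J) || (j == ord0).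
have tot : (\sum_(f in family Q) \prod_i w i (f i) <= 2 ^ (S.+1 * #|J|))%N.
  rewrite -(bigA_distr_big_dep (I := I) (J := 'I_S.+1) Q w).
  rewrite (bigID (mem J)) /= [X in (_ * X)%N]big1 ?muln1; last first.
    move=> i iJ; rewrite (eq_bigl (pred1 ord0)) ?big_pred1_eq; last first.
      by move=> j; rewrite /Q (negbTE iJ).
    by rewrite /w (negbTE iJ).
  rewrite expnM -prod_nat_const; apply: leq_prod => i iJ.
  rewrite (eq_bigl xpredT); last by move=> j; rewrite /Q iJ.
  rewrite (eq_bigr (fun j : 'I_S.+1 => 2 ^ (S - j))%N); last by move=> j _; rewrite /w iJ.
  exact/ltnW/sum_geom2_lt.
have low : (#|A| * 2 ^ (#|J| * S - S) <= \sum_(f in family Q) \prod_i w i (f i))%N.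
  rewrite -sum_nat_const big_mkcond [X in (_ <= X)%N]big_mkcond /=.
  apply: leq_sum => f _; case: ifP => // fA.
  move: fA; rewrite inE => /andP[/forallP fQ fS].
  have -> : f \in family Q by apply/familyP => i; rewrite /in_mem /= /Q fQ.
  rewrite (bigID (mem J)) /=.
  rewrite [X in (_ <= _ * X)%N]big1; last by move=> i iJ; rewrite /w (negbTE iJ).
  rewrite muln1.
  rewrite (eq_bigr (fun i => 2 ^ (S - f i))%N); last by move=> i iJ; rewrite /w iJ.
  rewrite -(big_morph (expn 2) (expnD 2) (expn0 2)) leq_exp2l //.
  have : (\sum_(i in J) (S - f i) + \sum_(i in J) f i = #|J| * S)%N.
    rewrite -big_split /= -sum_nat_const; apply: eq_bigr => i _.
    by rewrite subnK // -ltnS.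
  move: (\sum_(i in J) (S - f i))%N (\sum_(i in J) f i)%N fS => u v.
  lia.
have := leq_trans low tot.
have -> : (S.+1 * #|J| = (S + #|J|) + (#|J| * S - S))%N.
  have : (S <= #|J| * S)%N by rewrite leq_pmull.
  rewrite mulSn mulnC; lia.
by rewrite expnD leq_pmul2r // expn_gt0.
Qed.

(** Numerical labels stand for a partition, so that classes may be empty, successive refinements are
    encoded by arithmetic, and [E] need not be an equivalence. *)
Definition splits (X : Type) (A : set X) (N : nat) (E : X -> X -> Prop) : Prop :=
  exists2 l : X -> nat, (forall x, A x -> (l x < N)%N) &
    forall x y, A x -> A y -> l x = l y -> E x y.

Lemma splits1 (X : Type) (A : set X) (N : nat) (E : X -> X -> Prop) :
  (0 < N)%N -> (forall x y, A x -> A y -> E x y) -> splits A N E.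
Proof. by move=> N0 H; exists (fun=> 0%N) => // x y Ax Ay _; exact: H. Qed.

Lemma splitsW (X : Type) (A : set X) (N N' : nat) (E E' : X -> X -> Prop) :
  (N <= N')%N -> (forall x y, A x -> A y -> E x y -> E' x y) ->
  splits A N E -> splits A N' E'.
Proof.
move=> NN' EE' [l lN lE]; exists l => [x Ax|x y Ax Ay lxy].
  exact: leq_trans (lN x Ax) NN'.
by apply: EE' => //; exact: lE.
Qed.

Lemma splits_fin (X : Type) (F : finType) (s : {set F}) (A : set X) (f : X -> F) :
  (forall x, A x -> f x \in s) -> splits A #|s| (fun x y => f x = f y).
Proof.
move=> fs; exists (fun x => index (f x) (enum s)) => [x Ax|x y Ax Ay].
  by rewrite cardE index_mem mem_enum fs.
move=> /(congr1 (nth (f x) (enum s))).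
by rewrite !nth_index ?mem_enum ?fs.
Qed.

(** A second labelling is chosen on each class of the first. The pair of labels is encoded as l N2 +
    l2 and recovered by Euclidean division. *)
Lemma splits_refine (X : Type) (A : set X) (N1 N2 : nat)
    (E1 E2 : X -> X -> Prop) :
  splits A N1 E1 ->
  (forall B, B `<=` A -> (forall x y, B x -> B y -> E1 x y) -> splits B N2 E2) ->
  splits A (N1 * N2)%N (fun x y => E1 x y /\ E2 x y).
Proof.
move=> [l lN lE] H.
pose B n : set X := [set x | A x /\ l x = n].
have HB n : splits (B n) N2 E2.
  apply: H; first by move=> x [].
  by move=> x y [Ax lx] [Ay ly]; apply: lE => //; rewrite lx ly.
have /choice[l2 l2P] : forall n, exists l2 : X -> nat,
    (forall x, B n x -> (l2 x < N2)%N) /\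
    forall x y, B n x -> B n y -> l2 x = l2 y -> E2 x y.
  by move=> n; case: (HB n) => l2 h1 h2; exists l2.
exists (fun x => l x * N2 + l2 (l x) x)%N => [x Ax|x y Ax Ay].
  have := (l2P (l x)).1 x (conj Ax erefl); have := lN x Ax => h1 h2.
  rewrite (leq_trans (_ : _ < (l x).+1 * N2)%N) ?leq_mul2r ?h1 ?orbT //.
  by rewrite mulSn addnC ltn_add2r.
have hx := (l2P (l x)).1 x (conj Ax erefl).
have hy := (l2P (l y)).1 y (conj Ay erefl).
have N20 : (0 < N2)%N by case: (N2) hx.
move=> /[dup] /(congr1 (modn^~ N2)) /[swap] /(congr1 (divn^~ N2)).
rewrite !divnMDl // !divn_small // !addn0 !modnMDl !modn_small // => exy.
rewrite -exy => exy2; split; first exact: lE.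
by apply: (l2P (l x)).2 => //; split.
Qed.

(** * Grids *)

Definition distq (R : realType) (I : finType) (q : R) (J : {set I})
    (u v : I -> R) : R :=
  (\sum_(i in J) `|u i - v i| `^ q) `^ q^-1.

Lemma distq_ge0 (R : realType) (I : finType) (q : R) (J : {set I})
  (u v : I -> R) : 0 <= distq q J u v.
Proof. exact: powR_ge0. Qed.

(* Integers are enumerated as 0, -1, 1, -2, 2, ... . *)
Definition int_code (z : int) : nat :=
  match z with Posz n => n.*2 | Negz n => n.*2.+1 end.

Lemma int_code_inj : injective int_code.
Proof. by move=> [a|a] [b|b] /= ?; [congr Posz|exfalso|exfalso|congr Negz]; lia. Qed.

Lemma int_code_le (R : realType) (h : R) :
  (int_code (Num.floor h))%:R <= 2 * `|h| + 1.
Proof.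
have /andP[h1 h2] := floor_itv h.
case: (Num.floor h) h1 h2 => n /= h1 h2.
  have h0 : 0 <= h by apply: le_trans h1; rewrite ler0n.
  have -> : (n.*2)%:R = 2 * n%:R :> R by rewrite -mul2n natrM.
  by rewrite ger0_norm //; move: h1; rewrite -pmulrn; lra.
have -> : (n.*2.+1)%:R = 2 * n%:R + 1 :> R by rewrite -natr1 -mul2n natrM.
move: h1 h2; rewrite NegzE mulrNz -!pmulrn => h1 h2.
have E : (- n.+1%:Z + 1)%:~R = - n%:R :> R.
  by rewrite intrD mulrNz -!pmulrn -natr1; ring.
move: h2; rewrite E => h2.
have := ler0n R n => n0.
by rewrite ler0_norm; lra.
Qed.

(** Hölder against the constant function 1. *)
Lemma sum_norm_le_distq (R : realType) (I : finType) (q : R) (J : {set I})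
    (u v : I -> R) : 1 <= q ->
  \sum_(i in J) `|u i - v i| <= distq q J u v * #|J|%:R `^ (1 - q^-1).
Proof.
move=> q1; have q0 : 0 < q by lra.
have q01 : 0 <= q^-1 <= 1 by rewrite invr_ge0 ltW //= invf_le1.
have := @hoelder_sum R I J (fun i => `|u i - v i| `^ q) (fun=> 1) q^-1 _ _ q01.
rewrite sumr_const => /(_ (fun=> powR_ge0 _ _) (fun=> ler01)).
rewrite (eq_bigr (fun i => `|u i - v i|)) // => i _.
by rewrite powR1 mulr1 -powRrM divff ?gt_eqF // powRr1.
Qed.

(* The points are rounded to a grid of mesh [D / (4 #|J| ^ (1/q))]; by Hölder
   the resulting integer vectors have small l1 norm, so there are few of them. *)
Lemma splits_distq (R : realType) (I : finType) (X : Type) (A : set X)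
    (W : X -> I -> R) (q : R) (J : {set I}) (D : R) : 1 <= q ->
  (forall x y, A x -> A y -> distq q J (W x) (W y) <= D) ->
  splits A (2 ^ (12 * #|J|)) (fun x y => distq q J (W x) (W y) <= D / 4).
Proof.
move=> q1 HD; have q0 : 0 < q by lra.
have pos N : (0 < 2 ^ N)%N by rewrite expn_gt0.
have [[x0 Ax0]|A0] := pselect (A !=set0); last first.
  by apply: splits1 => // x y Ax; case: A0; exists x.
have D0 : 0 <= D by apply: le_trans (HD _ _ Ax0 Ax0); exact: distq_ge0.
have [De|Dn] := eqVneq D 0.
  by apply: splits1 => // x y Ax Ay; rewrite De mul0r -De; exact: HD.
have [J0|Jn] := posnP #|J|.
  apply: splits1 => // x y _ _; rewrite /distq (cards0_eq J0) big_set0.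
  by rewrite powR0 ?invr_eq0 ?gt_eqF // divr_ge0.
have Dp : 0 < D by rewrite lt_neqAle eq_sym Dn.
set N := #|J| in Jn *.
have NR : 0 < N%:R :> R by rewrite ltr0n.
pose s : R := N%:R `^ q^-1 * 4 / D.
have sp : 0 < s by rewrite divr_gt0 // mulr_gt0 // powR_gt0.
pose h x i := (W x i - W x0 i) * s.
pose c x i := int_code (Num.floor (h x i)).
(* Scaling by [s] makes the l1 norm of [h x] at most 4N, so the codes add up to at most 8N + N. The
   looser bound 11N fits the count 2^(11N + N) = 2^(12N) of the statement. *)
have csum x : A x -> (\sum_(i in J) c x i <= 11 * N)%N.
  move=> Ax; rewrite -(ler_nat R) natr_sum.
  apply: le_trans (_ : \sum_(i in J) (2 * `|h x i| + 1) <= _).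
    by apply: ler_sum => i _; exact: int_code_le.
  rewrite big_split /= -mulr_sumr sumr_const -/N.
  have : \sum_(i in J) `|h x i| <= 4 * N%:R; last by rewrite natrM; lra.
  rewrite (eq_bigr (fun i => `|W x i - W x0 i| * s)); last first.
    by move=> i _; rewrite normrM (gtr0_norm sp).
  rewrite -mulr_suml -ler_pdivlMr //.
  apply: le_trans (sum_norm_le_distq J _ _ q1) _.
  apply: le_trans (ler_wpM2r (powR_ge0 _ _) (HD _ _ Ax Ax0)) _.
  rewrite -/N ler_pdivlMr // le_eqVlt; apply/orP; left; apply/eqP.
  have -> : 4 * N%:R = 4 * (N%:R `^ (1 - q^-1) * N%:R `^ q^-1) :> R.
    by rewrite -powRD ?subrK ?powRr1 ?(ltW NR) // gt_eqF ?implybT.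
  by rewrite /s; field; rewrite gt_eqF.
have cle x i : A x -> i \in J -> (c x i < (11 * N).+1)%N.
  move=> Ax iJ; rewrite ltnS; apply: leq_trans (csum x Ax).
  by rewrite (bigD1 i) //= leq_addr.
pose f x : {ffun I -> 'I_(11 * N).+1} :=
  [ffun i => if i \in J then inord (c x i) else ord0].
apply: splitsW (splits_fin (f := f) (s := [set f : {ffun I -> 'I_(11 * N).+1} |
      [forall i, (i \in J) || (f i == ord0)]
      && (\sum_(i in J) f i <= 11 * N)%N]%SET) _).
- rewrite (leq_trans (card_ffun_sum_le _ _)) // leq_exp2l // -/N; lia.
- move=> x y Ax Ay /ffunP fxy.
  (* Equal codes mean equal floors, so each coordinate differs by at most 1/s = D / (4 N^(1/q)); N
     such coordinates add up to D/4 in l_q. *)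
  have key i : i \in J -> `|W x i - W y i| <= s^-1.
    move=> iJ; have := congr1 (@nat_of_ord _) (fxy i).
    rewrite /f !ffunE iJ !inordK ?cle // => /int_code_inj E.
    have /andP[h1 h2] := floor_itv (h x i); have /andP[h3 h4] := floor_itv (h y i).
    rewrite E in h1 h2; move: h2 h4; rewrite intrD => h2 h4.
    have : `|h x i - h y i| <= 1 by rewrite ler_norml; lra.
    have -> : h x i - h y i = (W x i - W y i) * s by rewrite /h; ring.
    by rewrite normrM (gtr0_norm sp) -ler_pdivlMr // mul1r.
  rewrite /distq; apply: le_trans (_ : (\sum_(i in J) s^-1 `^ q) `^ q^-1 <= _).
    rewrite ge0_ler_powR ?nnegrE ?sumr_ge0 ?invr_ge0 ?(ltW q0) //;
      try by move=> *; rewrite powR_ge0.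
    apply: ler_sum => i iJ; rewrite ge0_ler_powR ?nnegrE ?(ltW q0) ?key //.
    by rewrite invr_ge0 ltW.
  rewrite sumr_const -/N -[X in X `^ _]mulr_natr powRM ?powR_ge0 ?ler0n //.
  rewrite -powRrM divff ?gt_eqF // powRr1 ?invr_ge0 ?(ltW sp) //.
  rewrite le_eqVlt; apply/orP; left; apply/eqP; rewrite /s; field.
  by rewrite gt_eqF //= gt_eqF // powR_gt0.
- move=> x Ax; rewrite inE; apply/andP; split.
    by apply/forallP => i; rewrite ffunE; case: ifP.
  rewrite (eq_bigr (fun i => c x i)) ?csum // => i iJ.
  by rewrite ffunE iJ inordK ?cle.
Qed.

(** * Contraction along the levels *)

Lemma powR2_level_sum (R : realType) (p : R) (n : nat) : 1 <= p ->
  (2 `^ p^-1 - 1) * \sum_(0 <= j < n) 2 `^ (j%:R / p) = 2 `^ (n%:R / p) - 1 :> R.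
Proof.
move=> p1; elim: n => [|n IH].
  by rewrite big_nil mulr0 mul0r powRr0 subrr.
rewrite big_nat_recr //= mulrDr IH.
have -> : n.+1%:R / p = p^-1 + n%:R / p :> R by rewrite -natr1; ring.
by rewrite powRD ?pnatr_eq0 ?implybT //; ring.
Qed.

Lemma powR2_inv_gt1 (R : realType) (p : R) : 1 <= p -> 1 < 2 `^ p^-1 :> R.
Proof.
move=> p1; rewrite -[X in X < _](@powRr0 R 2) /powR pnatr_eq0 /= ltr_expR.
rewrite ltr_pM2r ?ln_gt0 ?ltr1n // invr_gt0; lra.
Qed.

Lemma powR2_inv_le2 (R : realType) (p : R) : 1 <= p -> 2 `^ p^-1 <= 2 :> R.
Proof.
move=> p1; rewrite -[leRHS](@powRr1 R 2) // ler_powR ?ler1n // invf_le1 //; lra.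
Qed.

Lemma Nadm_gt0 n : (0 < Nadm n)%N.
Proof. by case: n => // n; rewrite expn_gt0. Qed.

(** Room for the construction: cutting each block of level n into 2^(2^n) pieces respects the
    cardinality bound of level n + 1. *)
Lemma Nadm_step n : (Nadm n * 2 ^ (2 ^ n) <= Nadm n.+1)%N.
Proof.
by case: n => [//|n]; rewrite /Nadm -expnD addnn -mul2n -expnS.
Qed.

Section LabelPartition.
Variables (X : Type) (T : set X) (L : nat -> X -> nat).

Definition label_block n x := [set y | T y /\ L n y = L n x].
Definition label_partition n := [set label_block n x | x in T].

Lemma label_partition_partition n : partition (label_partition n) id T.
Proof.
split.
- apply/seteqP; split => [x [B [y Ty <-]] [] //|x Tx].
  by exists (label_block n x) => //; exists x.
- move=> _ _ [x Tx <-] [y Ty <-] [z [[_ h1] [_ h2]]].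
  by apply/seteqP; split=> u [Tu hu]; split=> //; rewrite hu -h1 -h2.
- by move=> _ [x Tx <-]; exists x.
Qed.

(** The blocks of level n are an image of the set of labels in use, which bounds their number;
    nested labels give nested blocks. *)
Lemma label_partition_admissible :
  (forall n x, T x -> (L n x < Nadm n)%N) ->
  (forall n x y, T x -> T y -> L n.+1 x = L n.+1 y -> L n x = L n y) ->
  admissible T label_partition.
Proof.
move=> LN Lnest n; split; first exact: label_partition_partition.
- have -> : label_partition n =
      (fun l => [set y | T y /\ L n y = l]) @` (L n @` T).
    by rewrite image_comp.
  apply: card_le_trans (card_image_le _ _) _; apply: subset_card_le.
  by move=> _ [x Tx <-]; exact: LN.
- move=> _ [x Tx <-]; exists (label_block n x); first by exists x.
  by move=> y [Ty Ly]; split=> //; exact: Lnest Ly.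
Qed.

Lemma pblock_label_partition n x : T x ->
  pblock (label_partition n) id x = label_block n x.
Proof.
move=> Tx; rewrite /pblock /pblock_index /=.
have [|[y Ty <-] [_ h]] := @getPex _ [set B | label_partition n B /\ B x].
  by exists (label_block n x); split => //; exists x.
by apply/seteqP; split => u [Tu hu]; split => //; rewrite hu h.
Qed.

End LabelPartition.

(** Diameters shrink by 4 per level while the weight 2^(n/p) grows by at most 2, so the weighted
    diameters contract by 1/2 and their sum is controlled by the initial term and the weighted
    errors. The comparison of [S k x] with [S k y] is needed because the diameter of a cell involves
    the errors at all its points, whereas the final sum follows a single point. *)
Lemma gamma_le_contraction (R : realType) (X : Type) (T : set X)
    (d : X -> X -> R) (p : R) (K0 : nat) (D B : R) (S : nat -> X -> R) :
  1 <= p -> T !=set0 ->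
  (forall x y, T x -> T y -> 0 <= d x y <= D) ->
  (forall k A D', (K0 <= k)%N -> A `<=` T ->
    (forall x y, A x -> A y -> d x y <= D') ->
    splits A (2 ^ (2 ^ k))
      (fun x y => d x y <= D' / 4 + S k x /\ S k x <= 2 * S k y)) ->
  (forall x n, T x -> \sum_(K0 <= k < n) 2 `^ (k%:R / p) * S k x <= B) ->
  (gamma p 1 T d <=
    (((2 `^ p^-1 - 1)^-1 + 2) * (2 `^ (K0%:R / p) * D) + 8 * B)%:E)%E.
Proof.
move=> p1 [t0 Tt0] dD H HB.
have D0 : 0 <= D by have /andP[] := dD _ _ Tt0 Tt0; exact: le_trans.
(* One labelling has to serve all upper bounds [D'] of a set at once, so it is taken for the
   supremum of the distances. *)
have /choice[l Hl] : forall nB : nat * set X, exists l : X -> nat,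
    (K0 <= nB.1)%N -> nB.2 `<=` T ->
    (forall x, nB.2 x -> (l x < 2 ^ (2 ^ nB.1))%N) /\
    forall x y, nB.2 x -> nB.2 y -> l x = l y ->
      (forall D', (forall u v, nB.2 u -> nB.2 v -> d u v <= D') ->
        d x y <= D' / 4 + S nB.1 x) /\
      S nB.1 x <= 2 * S nB.1 y.
  move=> [n A] /=; have [nK|] := boolP (K0 <= n)%N; last by exists (fun=> 0%N).
  have [AT|] := pselect (A `<=` T); last by exists (fun=> 0%N).
  pose E := [set d x y | x in A & y in A].
  have ubE : has_ubound E.
    by exists D => _ [x Ax [y Ay <-]]; have /andP[] := dD _ _ (AT _ Ax) (AT _ Ay).
  have [|l lN lP] := H n A (sup E) nK AT.
    by move=> x y Ax Ay; apply: ub_le_sup => //; exists x => //; exists y.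
  exists l => _ _; split=> // x y Ax Ay lxy; have [h1 h2] := lP x y Ax Ay lxy.
  split=> // D' HD'; apply: le_trans h1 _; rewrite lerD2r ler_pM2r ?invr_gt0 //.
  by apply: ge_sup; [exists (d x x), x => //; exists x|move=> _ [u Au [v Av <-]]; exact: HD'].
(* Below [K0] all points share the label 0; afterwards the new label is appended to the old one as a
   digit in base 2^(2^n'). *)
pose L := fix L (n : nat) : X -> nat := if n is n'.+1 then
    if (n' < K0)%N then fun=> 0%N else
    fun x => (L n' x * 2 ^ (2 ^ n') + l (n', [set y | T y /\ L n' y = L n' x]) x)%N
  else fun=> 0%N.
have LS n : (K0 <= n)%N -> L n.+1 =
    fun x => (L n x * 2 ^ (2 ^ n) + l (n, label_block T L n x) x)%N.
  by move=> nK; rewrite /= ltnNge nK.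
have LT n x : T x -> (L n x < Nadm n)%N.
  move=> Tx; elim: n => [//|n IH].
  have [nK|nK] := ltnP n K0.
    by rewrite (_ : L n.+1 x = 0%N) ?Nadm_gt0 //= nK.
  rewrite (LS n nK); apply: leq_trans (Nadm_step n).
  have [h _] := Hl (n, label_block T L n x) nK (fun _ => @proj1 _ _).
  have := h x (conj Tx erefl) => /= lt_l.
  rewrite (leq_trans (_ : _ < (L n x).+1 * 2 ^ (2 ^ n))%N) ?leq_mul2r ?IH ?orbT //.
  by rewrite mulSn addnC ltn_add2r.
have Lnest2 n x y : (K0 <= n)%N -> T x -> T y -> L n.+1 x = L n.+1 y ->
    L n x = L n y /\ l (n, label_block T L n x) x = l (n, label_block T L n x) y.
  move=> nK Tx Ty; rewrite (LS n nK).
  have hl z : T z -> (l (n, label_block T L n z) z < 2 ^ (2 ^ n))%N.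
    move=> Tz; have [h _] := Hl (n, label_block T L n z) nK (fun _ => @proj1 _ _).
    exact: h z (conj Tz erefl).
  have pos : (0 < 2 ^ (2 ^ n))%N by rewrite expn_gt0.
  move=> /[dup] /(congr1 (modn^~ (2 ^ (2 ^ n))%N)) /[swap] /(congr1 (divn^~ (2 ^ (2 ^ n))%N)).
  rewrite !divnMDl // !divn_small ?hl // !addn0 !modnMDl !modn_small ?hl // => e1 e2.
  by split=> //; rewrite e2 /label_block e1.
have Lnest n x y : T x -> T y -> L n.+1 x = L n.+1 y -> L n x = L n y.
  move=> Tx Ty; have [nK _|nK] := ltnP n K0; last by case/(Lnest2 n x y nK Tx Ty).
  by case: n nK => [//|n] nK /=; rewrite (ltn_trans (ltnSn n) nK).
(* The bound between y and z in the cell of x has the error at y; replacing it by the error at x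
   costs the factor 2. *)
pose Dl := fix Dl n x := if n is n'.+1 then
    if (n' < K0)%N then D else Dl n' x / 4 + 2 * S n' x else D.
have Dle n x y z : T x -> label_block T L n x y -> label_block T L n x z ->
    d y z <= Dl n x.
  move=> Tx; elim: n y z => [|n IH] y z [Ty Ly] [Tz Lz].
    by have /andP[] := dD _ _ Ty Tz.
  rewrite /=; case: ltnP => nK; first by have /andP[] := dD _ _ Ty Tz.
  have [ey ly] := Lnest2 n y x nK Ty Tx Ly.
  have [ez lz] := Lnest2 n z x nK Tz Tx Lz.
  have eB u : L n u = L n x -> label_block T L n u = label_block T L n x.
    by move=> h; rewrite /label_block h.
  rewrite (eB _ ey) in ly; rewrite (eB _ ez) in lz.
  have [_ h] := Hl (n, label_block T L n x) nK (fun _ => @proj1 _ _).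
  have [h1 _] := h y z (conj Ty ey) (conj Tz ez) (etrans ly (esym lz)).
  have [_ h2] := h y x (conj Ty ey) (conj Tx erefl) ly.
  by apply: le_trans (h1 (Dl n x) IH) _; rewrite lerD2l.
pose w n : R := 2 `^ (n%:R / p).
have w0 n : 0 <= w n by exact: powR_ge0.
have a1 := powR2_inv_gt1 p1; have a2 := powR2_inv_le2 p1.
have wS n : w n.+1 = 2 `^ p^-1 * w n.
  rewrite /w; have -> : n.+1%:R / p = p^-1 + n%:R / p by rewrite -natr1; ring.
  by rewrite powRD // pnatr_eq0 implybT.
have DlK n x : (n <= K0)%N -> Dl n x = D.
  by case: n => [//|n] nK; rewrite /= nK.
have S0 n x : (K0 <= n)%N -> T x -> 0 <= S n x.
  move=> nK Tx; have [_ h] := Hl (n, label_block T L n x) nK (fun _ => @proj1 _ _).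
  by have [_] := h x x (conj Tx erefl) (conj Tx erefl) erefl; rewrite /=; lra.
have Dl0 n x : T x -> 0 <= Dl n x.
  by move=> Tx; apply: le_trans (Dle n x x x Tx _ _) => //; have /andP[] := dD _ _ Tx Tx.
have low x n : T x -> (n <= K0)%N ->
    \sum_(0 <= j < n) w j * Dl j x <= (2 `^ p^-1 - 1)^-1 * (w K0 * D).
  move=> Tx nK; rewrite (@eq_big_nat _ _ _ _ _ _ (fun j => w j * D)); last first.
    by move=> j /andP[_ jn]; rewrite DlK // (leq_trans (ltnW jn)).
  rewrite -mulr_suml mulrA ler_wpM2r //.
  rewrite mulrC ler_pdivlMr ?subr_gt0 // mulrC powR2_level_sum // -/(w n).
  have : w n <= w K0; last lra.
  by rewrite ler_powR ?ler1n // ler_pM2r ?ler_nat // invr_gt0; lra.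
(* Carrying twice the next term on the left closes the induction: with u, v the weighted diameter
   and error, the new term is at most 2 (u/4 + 2v), and u + 2 (u/2 + 4v) = 2u + 8v. *)
have high x n : T x -> \sum_(K0 <= j < K0 + n) w j * Dl j x + 2 * (w (K0 + n)%N * Dl (K0 + n)%N x) <=
    2 * (w K0 * D) + 8 * \sum_(K0 <= j < K0 + n) w j * S j x.
  move=> Tx; elim: n => [|n IH].
    by rewrite addn0 !big_geq // DlK // mulr0 add0r addr0.
  rewrite addnS !big_nat_recr ?leq_addr //=.
  rewrite -/Dl ltnNge leq_addr /= wS.
  have h1 := w0 (K0 + n)%N; have h2 := Dl0 (K0 + n)%N x Tx.
  have h3 := S0 (K0 + n)%N x (leq_addr _ _) Tx.
  have h4 : 0 <= w (K0 + n)%N * Dl (K0 + n)%N x by rewrite mulr_ge0.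
  have h5 : 0 <= w (K0 + n)%N * S (K0 + n)%N x by rewrite mulr_ge0.
  move: IH h4 h5.
  set u := w _ * Dl _ _; set v := w _ * S _ _ => IH h4 h5.
  have -> : 2 `^ p^-1 * w (K0 + n)%N * (Dl (K0 + n)%N x / 4 + 2 * S (K0 + n)%N x) =
     2 `^ p^-1 * (u / 4 + 2 * v) by rewrite /u /v; field.
  have : 2 `^ p^-1 * (u / 4 + 2 * v) <= 2 * (u / 4 + 2 * v).
    by rewrite ler_wpM2r //; lra.
  lra.
have bound x n : T x -> \sum_(0 <= j < n) w j * Dl j x <=
    ((2 `^ p^-1 - 1)^-1 + 2) * (w K0 * D) + 8 * B.
  move=> Tx; have wD : 0 <= w K0 * D by rewrite mulr_ge0.
  have B0 : 0 <= B by apply: le_trans (HB x K0 Tx); rewrite big_geq.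
  have [nK|nK] := leqP n K0.
    by apply: le_trans (low x n Tx nK) _; lra.
  rewrite (@big_cat_nat _ _ _ K0) ?(ltnW nK) //=.
  have := low x K0 Tx (leqnn _).
  have := high x (n - K0)%N Tx; rewrite subnKC ?(ltnW nK) //.
  have := HB x n Tx; have : 0 <= w n * Dl n x by rewrite mulr_ge0 ?Dl0.
  by rewrite -/w; lra.
rewrite /gamma invr1 poweRe1; last first.
  apply: le_ereal_inf_tmp => _ [A _ <-]; apply: le_ereal_sup_tmp.
  exists (\sum_(0 <= n <oo) ((2 `^ (n%:R / p))%:E * diam (pblock (A n) id t0) d) `^ 1)%E.
    by exists t0.
  by apply: nneseries_ge0 => n _ _; exact: poweR_ge0.
apply: ge_ereal_inf; eexists.
  by exists (label_partition T L); [exact: label_partition_admissible|reflexivity].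
apply: ge_ereal_sup => _ [x Tx <-].
have diam0 n : (0 <= diam (label_block T L n x) d)%E.
  apply: le_ereal_sup_tmp; exists (d x x)%:E; first by exists x => //; exists x.
  by have /andP[] := dD _ _ Tx Tx.
apply: le_trans (lee_nneseries (v := fun n => (w n * Dl n x)%:E) _ _) _.
- by move=> n _ _; exact: poweR_ge0.
- move=> n _; rewrite pblock_label_partition // poweRe1; last first.
    by apply: mule_ge0; [rewrite lee_fin | exact: diam0].
  rewrite (EFinM (w n)) lee_wpmul2l ?lee_fin //; apply: ge_ereal_sup.
  by move=> _ [y hy [z hz <-]]; rewrite lee_fin; exact: Dle.
apply: lime_le.
  by apply: is_cvg_nneseries => n _ _; rewrite lee_fin mulr_ge0 ?Dl0.
by apply: nearW => n; rewrite sumEFin lee_fin; exact: bound.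
Qed.

(** * Interpolation *)

(* [E] dominates the l_r norm of [a], where [ip = 1/r]; this form covers
   [r = +oo] as [ip = 0]. *)
Definition hoelder_bound (R : realType) (I : finType) (a : I -> R) (E ip : R) :=
  forall (J : {set I}) (t : R) (g : I -> R), 0 <= t -> t * ip <= 1 ->
    (forall i, 0 <= g i) ->
    \sum_(i in J) a i `^ t * g i `^ (1 - t * ip) <=
    E `^ t * (\sum_(i in J) g i) `^ (1 - t * ip).

Section Interpolation.
Variables (R : realType) (I : finType) (p p0 K b E H : R) (x c a : I -> R).
Hypotheses (p2 : 2 <= p) (p01 : 1 < p0) (p0p : p0 <= p).
Hypotheses (K0 : 0 < K) (b0 : 0 < b) (E0 : 0 <= E) (H0 : 0 <= H).
Hypotheses (x0 : forall i, 0 <= x i) (c0 : forall i, 0 <= c i)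
  (xca : forall i, `|x i - c i| <= a i).
Hypotheses (xH : forall i, x i `^ (p - p0) <= H)
  (cH : forall i, c i `^ (p - p0) <= H).
Hypothesis aE : hoelder_bound a E (p0^-1 - p^-1).

Let Y := K `^ (p0 / p) * E `^ p0 * H / b `^ (p0 - 1).
Let q := conjugate_exponent p.
Let r i := Num.max (x i) (c i).

Let a0 i : 0 <= a i. Proof. exact: le_trans (xca i). Qed.
Let r0 i : 0 <= r i. Proof. by rewrite /r le_max x0. Qed.
Let rH i : r i `^ (p - p0) <= H. Proof. by rewrite /r maxEle; case: ifP. Qed.
Let pp : 0 < p. Proof. by have := p2; lra. Qed.
Let p0pos : 0 < p0. Proof. by have := p01; lra. Qed.
Let q0 : 0 < q. Proof. by apply: divr_gt0 => //; have := p2; lra. Qed.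
Let qV : q^-1 = 1 - p^-1.
Proof. by rewrite /q /conjugate_exponent invf_div; field; rewrite gt_eqF. Qed.
Let Y0 : 0 <= Y.
Proof. by rewrite /Y !mulr_ge0 ?invr_ge0 ?powR_ge0. Qed.

Let YE : Y = (K `^ p^-1 * E * H `^ p0^-1) `^ p0 * b `^ (1 - p0).
Proof.
rewrite /Y !powRM ?mulr_ge0 ?powR_ge0 // -!powRrM mulVf ?gt_eqF // powRr1 //.
by rewrite -[1 - p0]opprB powRN [p^-1 * p0]mulrC.
Qed.

(** The mean value bound gives |x^p - c^p| <= p a r^(p-1). In its q-th power, part of r is bounded
    through [H], and Hölder separates [a] from the remaining mass of r^p. AM-GM with weights 1/p0
    and 1 - 1/p0 then splits the product into [Y] and b times the mass. *)
Lemma distq_interpolation (J : {set I}) :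
  K `^ p^-1 * distq q J (fun i => x i `^ p) (fun i => c i `^ p) <=
  p * (b * \sum_(i in J) r i `^ p + Y).
Proof.
have [[[hp2 hp01] hp0p] hpp] := (p2, p01, p0p, pp).
set Q := \sum_(i in J) r i `^ p.
have Q0 : 0 <= Q by apply: sumr_ge0 => i _; exact: powR_ge0.
pose th := q * (p0^-1 - p^-1).
have thE : 1 - th = q * (1 - p0^-1).
  by rewrite /th -{1}(mulfV (lt0r_neq0 q0)) qV; ring.
have th1 : 0 <= 1 - th.
  by rewrite thE mulr_ge0 ?(ltW q0) // subr_ge0 invf_le1 // ltW.
have S1 : \sum_(i in J) `|x i `^ p - c i `^ p| `^ q <=
    p `^ q * H `^ (q / p0) * (E `^ q * Q `^ (1 - th)).
  apply: le_trans (_ : \sum_(i in J) p `^ q * H `^ (q / p0) *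
      (a i `^ q * (r i `^ p) `^ (1 - th)) <= _); last first.
    rewrite -mulr_sumr ler_wpM2l ?mulr_ge0 ?powR_ge0 //.
    apply: aE; rewrite ?(ltW q0) //; last by move=> i; exact: powR_ge0.
    by rewrite -/th; lra.
  apply: ler_sum => i _.
  have p1 : 1 <= p by lra.
  have h := powR_sub_le p1 (x0 i) (c0 i) (xca i).
  apply: le_trans (ge0_ler_powR (ltW q0) _ _ h) _; rewrite ?nnegrE ?normr_ge0 //.
    by rewrite !mulr_ge0 ?powR_ge0 // ltW.
  rewrite !powRM ?mulr_ge0 ?powR_ge0 ?(ltW pp) // -/(r i) -[leRHS]mulrA.
  rewrite ler_wpM2l ?powR_ge0 // mulrCA ler_wpM2l ?powR_ge0 //.
  rewrite -!powRrM.
  (* Both sides equal p. The first summand is the power estimated by [H], the second the power that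
     stays in the mass. *)
  have -> : (p - 1) * q = (p - p0) * (q / p0) + p * (1 - th).
    rewrite /th /q /conjugate_exponent; field.
    by rewrite !gt_eqF // subr_gt0; lra.
  rewrite powRD; last first.
    apply/implyP => /eqP h0; exfalso; move: h0.
    have -> : (p - p0) * (q / p0) + p * (1 - th) = p; last lra.
    rewrite /th /q /conjugate_exponent; field.
    by rewrite !gt_eqF // subr_gt0; lra.
  rewrite ler_wpM2r ?powR_ge0 // [leLHS]powRrM ge0_ler_powR ?nnegrE ?powR_ge0 ?rH //.
  by rewrite divr_ge0 // ltW.
have S2 : distq q J (fun i => x i `^ p) (fun i => c i `^ p) <=
    p * (E * H `^ p0^-1) * Q `^ (1 - p0^-1).
  rewrite /distq; apply: le_trans (ge0_ler_powR _ _ _ S1) _.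
  - by rewrite invr_ge0 ltW.
  - by rewrite nnegrE sumr_ge0 // => i _; exact: powR_ge0.
  - by rewrite nnegrE !mulr_ge0 ?powR_ge0.
  rewrite !powRM ?mulr_ge0 ?powR_ge0 // -!powRrM thE.
  have -> : q * q^-1 = 1 by rewrite divff ?gt_eqF.
  have -> : q / p0 / q = p0^-1 by field; rewrite !gt_eqF.
  have -> : q * (1 - p0^-1) / q = 1 - p0^-1 by field; rewrite !gt_eqF.
  rewrite !powRr1 ?(ltW pp) //.
  by rewrite le_eqVlt; apply/orP; left; apply/eqP; ring.
apply: le_trans (ler_wpM2l (powR_ge0 _ _) S2) _.
(* The power of b in [Y] is chosen so that b cancels from this product. *)
have -> : K `^ p^-1 * (p * (E * H `^ p0^-1) * Q `^ (1 - p0^-1)) =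
    p * (Y `^ p0^-1 * (b * Q) `^ (1 - p0^-1)).
  have Z0 : 0 <= K `^ p^-1 * E * H `^ p0^-1 by rewrite !mulr_ge0 ?powR_ge0.
  rewrite YE (powRM _ (ltW b0) Q0) (powRM _ (powR_ge0 _ _) (powR_ge0 _ _)).
  rewrite -!powRrM mulfV ?gt_eqF // powRr1 //.
  have -> : (1 - p0) / p0 = - (1 - p0^-1) by field; rewrite gt_eqF.
  rewrite powRN.
  have bn : b `^ (1 - p0^-1) != 0 by rewrite gt_eqF // powR_gt0.
  by field.
rewrite ler_pM2l //.
have p0V : 0 <= p0^-1 <= 1 by rewrite invr_ge0 invf_le1 // !ltW.
have bQ0 : 0 <= b * Q by rewrite mulr_ge0 // ltW.
apply: le_trans (weighted_AMGM Y0 bQ0 p0V) _.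
by have /andP[h1 h2] := p0V; rewrite addrC lerD // ler_piMl //; lra.
Qed.

(** Write x^p = x^p0 x^(p-p0) <= (2a)^p0 H and apply Hölder against the constant 1, which produces
    #|J|^(p0/p). The bound on #|J| turns this into K^(p0/p) b^(-p0), and the factor b in front
    completes [Y]. *)
Lemma sum_powR_far_le (J : {set I}) :
  (forall i, i \in J -> x i <= 2 * a i) -> #|J|%:R <= K / b `^ p ->
  b * \sum_(i in J) x i `^ p <= 2 `^ p * Y.
Proof.
move=> xa JK; have [[[hp2 hp01] hp0p] hpp] := (p2, p01, p0p, pp).
have th : 1 - p0 * (p0^-1 - p^-1) = p0 / p by field; rewrite !gt_eqF.
have S1 : \sum_(i in J) x i `^ p <= 2 `^ p * H * (E `^ p0 * #|J|%:R `^ (p0 / p)).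
  apply: le_trans (_ : \sum_(i in J) 2 `^ p * H * (a i `^ p0 * 1 `^ (p0 / p)) <= _).
    apply: ler_sum => i iJ; rewrite powR1 mulr1.
    have -> : x i `^ p = x i `^ p0 * x i `^ (p - p0).
      by rewrite -powRD ?subrKC // gt_eqF.
    rewrite -mulrA [H * _]mulrC mulrA ler_pM ?powR_ge0 //.
    apply: le_trans (ge0_ler_powR (ltW p0pos) _ _ (xa i iJ)) _;
      rewrite ?nnegrE ?mulr_ge0 //.
    by rewrite powRM // ler_wpM2r ?powR_ge0 // ler_powR ?ler1n.
  rewrite -mulr_sumr ler_wpM2l ?mulr_ge0 ?powR_ge0 //.
  have := @aE J p0 (fun=> 1) (ltW p0pos) _ (fun=> ler01).
  by rewrite th sumr_const; apply; rewrite -subr_ge0 th divr_ge0 // ltW.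
apply: le_trans (ler_wpM2l (ltW b0) S1) _.
have JK' : #|J|%:R `^ (p0 / p) <= K `^ (p0 / p) * b `^ (- p0).
  apply: le_trans (ge0_ler_powR _ _ _ JK) _; rewrite ?nnegrE ?divr_ge0 ?powR_ge0 ?(ltW K0) ?(ltW pp) ?(ltW p0pos) //.
  rewrite -powRN powRM ?powR_ge0 ?(ltW K0) // -powRrM.
  by have -> : - p * (p0 / p) = - p0 by field; rewrite gt_eqF.
have -> : 2 `^ p * Y = b * (2 `^ p * H * (E `^ p0 * (K `^ (p0 / p) * b `^ (- p0)))).
  rewrite /Y -powRN opprB.
  have -> : b `^ (1 - p0) = b * b `^ (- p0).
    by rewrite powRD ?(gt_eqF b0) ?implybT // powRr1 // ltW.
  by ring.
rewrite ler_pM2l // ler_wpM2l ?mulr_ge0 ?powR_ge0 //.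
by rewrite ler_wpM2l ?powR_ge0.
Qed.

End Interpolation.

(** * Estimates off the large coordinates *)

Lemma distq_setID (R : realType) (I : finType) (q : R) (A B : {set I})
    (u v : I -> R) : 1 <= q ->
  distq q A u v <= distq q (A :&: B) u v + distq q (A :\: B) u v.
Proof.
move=> q1; rewrite /distq (big_setID B) /=; apply: powR_addl_le.
- by apply: sumr_ge0 => i _; exact: powR_ge0.
- by apply: sumr_ge0 => i _; exact: powR_ge0.
- by rewrite invr_ge0 invf_le1 //; lra.
Qed.

Definition window_mass (R : realType) (I : finType) (p lo hi : R) (x : I -> R) :=
  \sum_(i | lo <= x i `^ p < hi) x i `^ p.

Lemma window_mass_ge0 (R : realType) (I : finType) (p lo hi : R) (x : I -> R) :
  0 <= window_mass p lo hi x.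
Proof. by apply: sumr_ge0 => i _; exact: powR_ge0. Qed.

(** Entries of size at most lo satisfy |u - v|^q <= lo^(q-1) (u + v); sum over the total mass and
    take the q-th root, using (q - 1)/q = 1/p. *)
Lemma distq_tail_le (R : realType) (I : finType) (p q lo M : R) (J : {set I})
    (u v : I -> R) : 1 < p -> q = conjugate_exponent p -> 0 < lo -> 0 <= M ->
  (forall i, 0 <= u i) -> (forall i, 0 <= v i) ->
  (forall i, i \in J -> Num.max (u i) (v i) <= lo) ->
  \sum_i u i <= M -> \sum_i v i <= M ->
  distq q J u v <= lo `^ p^-1 * (2 * M `^ (1 - p^-1)).
Proof.
move=> p1 qE lo0 M0 u0 v0 hJ hu hv.
have pp : 0 < p by lra.
have q1 : 1 < q by rewrite qE /conjugate_exponent ltr_pdivlMr; lra.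
have qV : q^-1 = 1 - p^-1.
  by rewrite qE /conjugate_exponent invf_div; field; rewrite gt_eqF.
have S1 : \sum_(i in J) `|u i - v i| `^ q <= lo `^ (q - 1) * (2 * M).
  apply: le_trans (_ : \sum_(i in J) lo `^ (q - 1) * (u i + v i) <= _).
    apply: ler_sum => i iJ; have h := hJ i iJ.
    have d0 := normr_ge0 (u i - v i).
    have h1 : `|u i - v i| <= lo.
      have := u0 i; have := v0 i; move: h; rewrite ge_max ler_norml => /andP[]; lra.
    have h2 : `|u i - v i| <= u i + v i.
      by have := u0 i; have := v0 i; rewrite ler_norml; lra.
    rewrite -(mulr_powRB1 d0) ?(lt_trans ltr01) // mulrC ler_pM ?powR_ge0 //.
    by rewrite ge0_ler_powR ?nnegrE ?(ltW lo0) //; lra.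
  rewrite -mulr_sumr ler_wpM2l ?powR_ge0 // (le_trans (_ : _ <= \sum_i (u i + v i))) //.
    rewrite [leRHS](bigID (mem J)) /= lerDl sumr_ge0 // => i _.
    by rewrite addr_ge0.
  by rewrite big_split /=; lra.
rewrite /distq; apply: le_trans (ge0_ler_powR _ _ _ S1) _.
- by rewrite invr_ge0; lra.
- by rewrite nnegrE sumr_ge0 // => i _; exact: powR_ge0.
- by rewrite nnegrE !mulr_ge0 ?powR_ge0.
rewrite !powRM ?mulr_ge0 ?powR_ge0 // -powRrM.
have -> : (q - 1) / q = p^-1.
  by rewrite mulrBl mulfV ?mul1r ?qV; [ring | rewrite gt_eqF // (lt_trans ltr01)].
rewrite qV ler_wpM2l ?powR_ge0 // ler_wpM2r ?powR_ge0 //.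
rewrite -[leRHS](@powRr1 R 2) // ler_powR ?ler1n //.
have pV : 0 <= p^-1 by rewrite invr_ge0 ltW.
lra.
Qed.

Section Core.
Variables (R : realType) (I : finType) (p p0 K b E H M al nu : R) (x c a : I -> R).
Hypotheses (p2 : 2 <= p) (p01 : 1 < p0) (p0p : p0 <= p).
Hypotheses (K0 : 0 < K) (b0 : 0 < b) (E0 : 0 <= E) (H0 : 0 <= H) (M0 : 0 < M)
  (al0 : 0 < al) (nu0 : 0 < nu).
Hypotheses (x0 : forall i, 0 <= x i) (c0 : forall i, 0 <= c i)
  (xca : forall i, `|x i - c i| <= a i).
Hypotheses (xH : forall i, x i `^ (p - p0) <= H)
  (cH : forall i, c i `^ (p - p0) <= H).
Hypothesis aE : hoelder_bound a E (p0^-1 - p^-1).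
Hypotheses (xM : \sum_i x i `^ p <= M) (cM : \sum_i c i `^ p <= M).

Definition lo_level := M / (al * K * nu).
(** The two entries of the maximum have separate uses: the first rules out that c is the larger
    modulus off the large coordinates, the second bounds the number of coordinates above the level
    by K / b^p. *)
Definition hi_level := M * Num.max al^-1 (b `^ p) / K.

(** Coordinates below [lo_level] give the last term by the tail bound. On the others interpolation
    leaves b times the mass of max(x, c)^p and one [Y]; the mass inside the window belongs to x or
    to c, and the mass above it costs 2^p [Y]. *)
Lemma distq_off_large_le (J : {set I}) :
  (forall i, i \in J -> (2 * c i) `^ p < M / (al * K)) ->
  K `^ p^-1 * distq (conjugate_exponent p) J (fun i => x i `^ p) (fun i => c i `^ p) <=
  p * (b * (window_mass p lo_level hi_level x + window_mass p lo_level hi_level c)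
    + (1 + 2 `^ p) * (K `^ (p0 / p) * E `^ p0 * H / b `^ (p0 - 1)))
  + 2 * M / (al * nu) `^ p^-1.
Proof.
move=> hJ; have [[[hp2 hp01] hp0p] hM] := (p2, p01, p0p, M0).
have pp : 0 < p by lra.
set Y := K `^ (p0 / p) * E `^ p0 * H / b `^ (p0 - 1).
have Y0 : 0 <= Y by rewrite /Y !mulr_ge0 ?invr_ge0 ?powR_ge0.
pose r i := Num.max (x i) (c i).
have r0 i : 0 <= r i by rewrite /r le_max x0.
have rE i : r i `^ p = Num.max (x i `^ p) (c i `^ p).
  rewrite /r !maxEle; case: ifPn => h; case: ifPn => h' //.
    by move: h'; rewrite ge0_ler_powR ?nnegrE ?(ltW pp).
  move: h; rewrite -ltNge => h; have := gt0_ltr_powR pp _ _ h.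
  by rewrite !nnegrE x0 c0 => /(_ isT isT); rewrite ltNge h'.
have lo0 : 0 < lo_level by rewrite /lo_level divr_gt0 // !mulr_gt0.
pose B := [set i | lo_level <= r i `^ p]%SET.
have q1 : 1 <= conjugate_exponent p.
  by rewrite /conjugate_exponent ler_pdivlMr; lra.
have KP : 0 <= K `^ p^-1 by exact: powR_ge0.
apply: le_trans (ler_wpM2l KP (distq_setID J B _ _ q1)) _.
rewrite mulrDr; apply: lerD; last first.
  have := @distq_tail_le R I p _ lo_level M (J :\: B) (fun i => x i `^ p)
    (fun i => c i `^ p) _ erefl lo0 (ltW M0) (fun i => powR_ge0 _ _)
    (fun i => powR_ge0 _ _) _ xM cM.
  move=> /(_ _ _)/(ler_wpM2l KP) h; apply: le_trans (h _ _) _.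
  - lra.
  - by move=> i; rewrite !inE -ltNge -rE => /andP[/ltW].
  have -> : K `^ p^-1 * (lo_level `^ p^-1 * (2 * M `^ (1 - p^-1))) =
      2 * (M `^ p^-1 * M `^ (1 - p^-1)) / (al * nu) `^ p^-1.
    rewrite -powRN mulrA -powRM ?(ltW K0) ?(ltW lo0) //.
    have -> : K * lo_level = M * (al * nu)^-1.
      by rewrite /lo_level; field; rewrite !gt_eqF.
    rewrite powRM ?(ltW M0) ?invr_ge0 ?mulr_ge0 ?(ltW al0) ?(ltW nu0) //.
    have -> : (al * nu)^-1 `^ p^-1 = (al * nu) `^ - p^-1.
      by rewrite -powR_inv1 ?mulr_ge0 ?(ltW al0) ?(ltW nu0) // -powRrM mulN1r.
    by ring.
  rewrite -powRD ?subrKC ?oner_eq0 // powRr1 ?(ltW M0) //.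
apply: le_trans (distq_interpolation K p2 p01 p0p b0 E0 H0 x0 c0 xca xH cH aE _) _.
rewrite ler_pM2l // -/Y.
suff : b * \sum_(i in J :&: B) Num.max (x i) (c i) `^ p <=
    b * (window_mass p lo_level hi_level x + window_mass p lo_level hi_level c) + 2 `^ p * Y.
  by rewrite [(1 + _) * Y]mulrDl mul1r; lra.
pose C := [set i | r i `^ p < hi_level]%SET.
rewrite (big_setID C) /= mulrDr; apply: lerD.
  rewrite ler_pM2l // /window_mass big_mkcond [X in _ <= X + _]big_mkcond.
  rewrite [X in _ <= _ + X]big_mkcond -big_split /=; apply: ler_sum => i _.
  rewrite !inE -/(r i); case: ifP => [/andP[/andP[_ h1] h2]|_]; last first.
    by rewrite addr_ge0 //; case: ifP => // _; exact: powR_ge0.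
  move: h1 h2; rewrite rE maxEle; case: ifP => _ h1 h2.
    by rewrite h1 h2 /= lerDr; case: ifP => // _; exact: powR_ge0.
  by rewrite h1 h2 /= lerDl; case: ifP => // _; exact: powR_ge0.
have hiM : M / (al * K) <= hi_level.
  rewrite /hi_level invfM mulrA ler_pM2r ?invr_gt0 // ler_pM2l //.
  by rewrite le_max lexx.
have hib : M * b `^ p / K <= hi_level.
  by rewrite /hi_level ler_pM2r ?invr_gt0 // ler_pM2l // le_max lexx orbT.
(* Above [hi_level] the larger modulus exceeds 2c, so it is x, and a >= x - c >= x/2. *)
have key i : i \in (J :&: B) :\: C -> [/\ r i = x i, x i <= 2 * a i & hi_level <= x i `^ p].
  rewrite !inE -leNgt => /andP[h1 /andP[iJ _]].
  have h2 := lt_le_trans (hJ i iJ) (le_trans hiM h1).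
  have h3 : 2 * c i < r i.
    rewrite ltNge; apply/negP => h; move: h2; rewrite ltNge => /negP; apply.
    by rewrite ge0_ler_powR ?nnegrE ?(ltW pp) ?mulr_ge0.
  have rx : r i = x i.
    move: h3; rewrite /r maxEle; case: ifP => // _.
    by have := c0 i; lra.
  split => //; last by rewrite -rx.
  have := xca i; rewrite ler_norml => /andP[_]; rewrite rx in h3.
  by have := c0 i; lra.
rewrite (eq_bigr (fun i => x i `^ p)); last by move=> i /key[]; rewrite /r => -> _ _.
apply: (sum_powR_far_le p2 p01 p0p K0 b0 H0 x0 xca xH aE).
  by move=> i /key[].
have hi0 : 0 < M * b `^ p / K by rewrite divr_gt0 // mulr_gt0 // powR_gt0.
(* Markov's inequality: each of these coordinates carries mass at least M b^p / K out of a total of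
   at most M. *)
have -> : K / b `^ p = M / (M * b `^ p / K).
  by field; rewrite !gt_eqF ?powR_gt0.
rewrite ler_pdivlMr // (le_trans _ xM) // (bigID (mem ((J :&: B) :\: C))) /=.
rewrite (le_trans (_ : _ <= \sum_(i in (J :&: B) :\: C) x i `^ p)) //; last first.
  by rewrite lerDl sumr_ge0 // => i _; exact: powR_ge0.
rewrite mulr_natl -sumr_const; apply: ler_sum => i /key[_ _].
exact: le_trans.
Qed.

End Core.

(** * Levels at which a coordinate is in the window *)

(** If s is the smallest exponent that is hit, all others lie in [s, s + J). Positivity of [A]
    follows from the existence of such an s. *)
Lemma dyadic_level_count (R : realType) (A : R) (J n m : nat) :
  (\sum_(n <= k < m) ((A <= 2 ^+ k) && (2 ^+ k < A * 2 ^+ J))%R <= J)%N.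
Proof.
pose P k := (A <= 2 ^+ k) && (2 ^+ k < A * 2 ^+ J).
have [[k0 Pk0]|no] := pselect (exists k, P k); last first.
  by rewrite big1 // => k _; case E : (_ && _) => //; case: no; exists k.
have [s Ps smin] := ex_minnP (ex_intro (fun k => P k) k0 Pk0).
have [Jlo Jhi] := andP Ps.
have A0 : 0 < A.
  rewrite -(@pmulr_lgt0 _ (2 ^+ J)) ?exprn_gt0 //.
  by apply: lt_trans Jhi; rewrite exprn_gt0.
have H k : (P k <= ((s <= k) && (k < s + J)))%N.
  case Pk : (P k) => //; rewrite smin //=.
  have /andP[_ h] := Pk.
  have : (2 : R) ^+ k < 2 ^+ (s + J).
    by apply: lt_le_trans h _; rewrite exprD ler_pM2r ?exprn_gt0.
  by rewrite ltr_eXn2l ?ltr1n // => ->.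
apply: leq_trans (leq_sum _ (fun k _ => H k)) _.
rewrite -big_mkcond /= sum1_count.
apply: (@leq_trans (size (iota s J))); last by rewrite size_iota.
rewrite -size_filter; apply: uniq_leq_size.
  by rewrite filter_uniq // iota_uniq.
by move=> k; rewrite mem_filter mem_iota => /andP[].
Qed.

(** Exchange the sums over levels and coordinates. The ends of the window have ratio 2^n0 max(1, al
    b^p) <= 2^(n0+J) and scale like 2^(-k), so each coordinate is counted at no more than n0 + J
    levels. *)
Lemma window_mass_sum_le (R : realType) (I : finType) (p M b al : R)
    (n0 J n m : nat) (x : I -> R) :
  0 < M -> 0 < al -> Num.max 1 (al * b `^ p) <= 2 ^+ J ->
  (forall i, 0 <= x i) -> \sum_i x i `^ p <= M ->
  \sum_(n <= k < m) window_mass p (lo_level (2 ^+ k) M al (2 ^+ n0))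
     (hi_level p (2 ^+ k) b M al) x <= (n0 + J)%:R * M.
Proof.
move=> M0 al0 hJ x0 xM.
pose P k i := (lo_level (2 ^+ k) M al (2 ^+ n0) <= x i `^ p) &&
  (x i `^ p < hi_level p (2 ^+ k) b M al).
rewrite /window_mass.
rewrite (eq_bigr (fun k => \sum_i (P k i)%:R * x i `^ p)); last first.
  move=> k _; rewrite big_mkcond; apply: eq_bigr => i _; rewrite -/(P k i).
  by case: (P k i); rewrite ?mul1r ?mul0r.
rewrite exchange_big /=.
apply: le_trans (_ : \sum_i (n0 + J)%:R * x i `^ p <= _); last first.
  by rewrite -mulr_sumr ler_wpM2l.
apply: ler_sum => i _; rewrite -mulr_suml.
have [u0|un] := eqVneq (x i `^ p) 0; first by rewrite u0 !mulr0.
have u0 : 0 < x i `^ p by rewrite lt_neqAle eq_sym un powR_ge0.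
rewrite ler_pM2r // -natr_sum ler_nat.
apply: leq_trans (dyadic_level_count (M / (al * 2 ^+ n0 * x i `^ p)) (n0 + J) n m).
apply: leq_sum => k _; rewrite /P.
case E : (_ && _) => //; move/andP: E => [h1 h2].
have k0 : 0 < 2 ^+ k :> R by rewrite exprn_gt0.
have n00 : 0 < 2 ^+ n0 :> R by rewrite exprn_gt0.
have -> : M / (al * 2 ^+ n0 * x i `^ p) <= 2 ^+ k.
  move: h1; rewrite /lo_level !ler_pdivrMr ?mulr_gt0 //.
  by congr (_ <= _); ring.
rewrite /= lt0b.
have -> : M / (al * 2 ^+ n0 * x i `^ p) * 2 ^+ (n0 + J) = M * (2 ^+ J / al) / x i `^ p.
  by rewrite exprD; field; rewrite !gt_eqF.
rewrite ltr_pdivlMr //.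
move: h2; rewrite /hi_level ltr_pdivlMr // mulrC => h2.
apply: lt_le_trans h2 _; rewrite ler_pM2l // ler_pdivlMr //.
apply: le_trans hJ; rewrite maxr_pMl ?(ltW al0) // mulVf ?gt_eqF //.
by rewrite [b `^ p * al]mulrC.
Qed.

(** With be = b al^(1/p) and t its integer part, be <= t + 1 <= 2^t, hence al b^p = be^p <= 2^(tp).
    This J, multiplied by b, is the origin of the term b^2 alpha0^(1/p). *)
Lemma pow2_exponent (R : realType) (p b al : R) : 1 <= p -> 0 <= b -> 0 <= al ->
  exists2 J : nat, Num.max 1 (al * b `^ p) <= 2 ^+ J &
    J%:R <= p * (b * al `^ p^-1) + 1.
Proof.
move=> p1 b0 al0; have pp : 0 < p by lra.
pose be := b * al `^ p^-1; have be0 : 0 <= be by rewrite mulr_ge0 ?powR_ge0.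
have beE : al * b `^ p = be `^ p.
  by rewrite powRM ?powR_ge0 // -powRrM mulVf ?gt_eqF // powRr1 // mulrC.
pose t := Num.truncn be.
have /andP[t1 t2] := truncn_itv be0; rewrite -/t in t1 t2.
have tp0 : 0 <= t%:R * p by rewrite mulr_ge0 // ltW.
pose J := (Num.truncn (t%:R * p)).+1.
have /andP[s1 s2] := truncn_itv tp0.
exists J; last first.
  rewrite /J -natr1 -/be lerD2r (le_trans s1) // mulrC ler_pM2l //.
rewrite ge_max exprn_ege1 ?ler1n // beE.
apply: le_trans (_ : (2 `^ t%:R) `^ p <= _).
  rewrite ge0_ler_powR ?nnegrE ?powR_ge0 ?(ltW pp) // powR_mulrn //.
  by apply: le_trans (ltW t2) _; rewrite -natrX ler_nat ltn_expl.
by rewrite -powRrM -powR_mulrn // ler_powR ?ler1n // ltW.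
Qed.

(** * One middle level *)

(** The constant 2 is affordable and avoids Minkowski: |u - v| <= 2 max(|u - w|, |v - w|), and the
    q-th root is subadditive. *)
Lemma distq_quasi_triangle (R : realType) (I : finType) (q : R) (J : {set I})
    (u v w : I -> R) : 1 <= q ->
  distq q J u v <= 2 * (distq q J u w + distq q J v w).
Proof.
move=> q1; have q0 : 0 < q by lra.
pose s := \sum_(i in J) `|u i - w i| `^ q.
pose t := \sum_(i in J) `|v i - w i| `^ q.
have s0 : 0 <= s by apply: sumr_ge0 => i _; exact: powR_ge0.
have t0 : 0 <= t by apply: sumr_ge0 => i _; exact: powR_ge0.
have H : \sum_(i in J) `|u i - v i| `^ q <= 2 `^ q * (s + t).
  rewrite /s /t -big_split mulr_sumr /=; apply: ler_sum => i _.
  set a := `|u i - w i|; set b := `|v i - w i|.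
  have ab : `|u i - v i| <= 2 * Num.max a b.
    have := ler_distD (w i) (u i) (v i); rewrite -/a [`|w i - v i|]distrC -/b.
    have : a <= Num.max a b by rewrite le_max lexx.
    have : b <= Num.max a b by rewrite le_max lexx orbT.
    lra.
  have m0 : 0 <= Num.max a b by rewrite le_max normr_ge0.
  apply: le_trans (ge0_ler_powR (ltW q0) _ _ ab) _;
    rewrite ?nnegrE ?mulr_ge0 //.
  rewrite powRM // ler_wpM2l ?powR_ge0 // maxEle.
  by case: ifP => _; rewrite ?lerDl ?lerDr powR_ge0.
rewrite /distq -/s -/t; apply: le_trans (ge0_ler_powR _ _ _ H) _.
- by rewrite invr_ge0 ltW.
- by rewrite nnegrE sumr_ge0 // => i _; exact: powR_ge0.
- by rewrite nnegrE !mulr_ge0 ?powR_ge0 ?addr_ge0.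
rewrite powRM ?powR_ge0 ?addr_ge0 // -powRrM divff ?gt_eqF // powRr1 //.
by rewrite ler_pM2l // powR_addl_le // invr_ge0 invf_le1 // ltW.
Qed.

Lemma lin_combine (R : realDomainType) (A1 A2 a1 a2 a3 a4 s : R) :
  A1 <= a1 + a3 + s -> A2 <= a2 + a3 + s ->
  a2 <= a1 + a4 -> a3 <= a1 + a4 -> 0 <= a4 ->
  2 * (A1 + A2) <= 4 * (2 * (a1 + a4) + s).
Proof. lra. Qed.

Section Level.
Variables (R : realType) (I : finType) (X : Type) (W : X -> I -> R)
  (dW : X -> X -> I -> R) (p p0 b H M al : R) (n0 : nat).
Hypotheses (p2 : 2 <= p) (p01 : 1 < p0) (p0p : p0 <= p).
Hypotheses (b0 : 0 < b) (H0 : 0 <= H) (M0 : 0 < M) (al0 : 0 < al)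
  (al24 : 24 * (2 `^ p * al) <= 1).

Let q := conjugate_exponent p.

Definition level_mass (k : nat) (x : X) : R :=
  window_mass p (lo_level (2 ^+ k) M al (2 ^+ n0)) (hi_level p (2 ^+ k) b M al) (W x).

(* [E] stands for the p1-diameter of the cell of [x]. *)
Definition level_cost (k : nat) (E : R) (x : X) : R :=
  4 * (p * (b * (2 * (level_mass k x + M / 2 ^+ k))
            + (1 + 2 `^ p) * ((2 ^+ k) `^ (p0 / p) * E `^ p0 * H / b `^ (p0 - 1)))
       + 2 * M / (al * 2 ^+ n0) `^ p^-1).

Lemma level_mass_ge0 k x : 0 <= level_mass k x.
Proof. exact: window_mass_ge0. Qed.

(** The summand M / 2^k inside the cost absorbs the accuracy to which masses agree on a class, so
    the cost varies there by at most a factor 2, as the contraction argument demands. *)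
Lemma level_cost_le k E x y : level_mass k x <= level_mass k y + M / 2 ^+ k ->
  level_cost k E x <= 2 * level_cost k E y.
Proof.
move=> h; have [[hp2 hb] hM] := (p2, b0, M0).
have k0 : 0 < M / 2 ^+ k by rewrite divr_gt0 ?exprn_gt0.
rewrite /level_cost [leRHS]mulrCA ler_pM2l //.
set t := 2 * M / _.
have t0 : 0 <= t by rewrite !mulr_ge0 ?invr_ge0 ?powR_ge0 // ltW.
set Y := (1 + _) * _.
have Y0 : 0 <= p * Y.
  have pp : 0 <= p by lra.
  by rewrite !mulr_ge0 ?invr_ge0 ?addr_ge0 ?powR_ge0.
have bp : 0 < p * b by rewrite mulr_gt0 //; lra.
have E1 z : p * (b * z + Y) = p * b * z + p * Y by ring.
rewrite !E1; have : p * b * (2 * (level_mass k x + M / 2 ^+ k)) <=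
    p * b * (2 * (2 * (level_mass k y + M / 2 ^+ k))).
  by rewrite ler_pM2l //; have := level_mass_ge0 k y; lra.
lra.
Qed.

(** Fix a centre c in the cell. The coordinates where c is large are few enough for a grid using
    half of the exponent 2^k; elsewhere no splitting is done, and x and y are both compared with
    c. *)
Lemma splits_level (A : set X) (k : nat) (E D : R) : (0 < k)%N -> 0 <= E ->
  (forall x i, 0 <= W x i) ->
  (forall x, A x -> \sum_i W x i `^ p <= M) ->
  (forall x i, A x -> W x i `^ (p - p0) <= H) ->
  (forall x y i, `|W x i - W y i| <= dW x y i) ->
  (forall x y, A x -> A y -> hoelder_bound (dW x y) E (p0^-1 - p^-1)) ->
  (forall x y, A x -> A y -> level_mass k x <= level_mass k y + M / 2 ^+ k) ->
  (forall x y, A x -> A y ->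
    distq q [set: I]%SET (fun i => W x i `^ p) (fun i => W y i `^ p) <= D) ->
  splits A (2 ^ (2 ^ k.-1)) (fun x y =>
    distq q [set: I]%SET (fun i => W x i `^ p) (fun i => W y i `^ p) <=
    D / 4 + level_cost k E x / (2 ^+ k) `^ p^-1).
Proof.
move=> k0 E0 W0 WM WH dWle dWE mass hD.
have [[hp2 hb] hM] := (p2, b0, M0).
have pp : 0 < p by lra.
have q1 : 1 <= q by rewrite /q /conjugate_exponent ler_pdivlMr; lra.
have [[c Ac]|A0] := pselect (A !=set0); last first.
  apply: splits1; first by rewrite expn_gt0.
  by move=> x y Ax; case: A0; exists x.
have K0 : 0 < 2 ^+ k :> R by rewrite exprn_gt0.
pose th := M / (al * 2 ^+ k).
have th0 : 0 < th by rewrite divr_gt0 // mulr_gt0.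
pose L := [set i | th <= (2 * W c i) `^ p]%SET.
(* Markov's inequality gives #|L| <= 2^p al 2^k <= 2^k / 24. *)
have cardL : (12 * #|L| <= 2 ^ k.-1)%N.
  have h1 : #|L|%:R * th <= 2 `^ p * M.
    apply: le_trans (_ : \sum_i (2 * W c i) `^ p <= _).
      rewrite (bigID (mem L)) /= mulr_natl -sumr_const.
      rewrite (le_trans (_ : _ <= \sum_(i in L) (2 * W c i) `^ p)) //.
        by apply: ler_sum => i; rewrite inE.
      by rewrite lerDl sumr_ge0 // => i _; exact: powR_ge0.
    rewrite (eq_bigr (fun i => 2 `^ p * W c i `^ p)); last by move=> i _; rewrite powRM.
    by rewrite -mulr_sumr ler_wpM2l ?powR_ge0 // WM.
  have h2 : #|L|%:R <= 2 `^ p * al * 2 ^+ k.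
    have -> : 2 `^ p * al * 2 ^+ k = 2 `^ p * M / th.
      by rewrite /th; field; rewrite !gt_eqF.
    by rewrite ler_pdivlMr.
  rewrite -(ler_nat R) natrM natrX.
  have h3 : 24 * (2 `^ p * al) * 2 ^+ k <= 1 * 2 ^+ k by rewrite ler_pM2r.
  have h4 : 2 ^+ k = 2 * 2 ^+ k.-1 :> R by rewrite -exprS prednK.
  move: h2 h3; rewrite h4; move: (2 `^ p * al) => z; lra.
have := @splits_distq R I X A (fun x i => W x i `^ p) q L D q1 _.
have TL : [set: I]%SET :&: L = L by rewrite finset.setTI.
have sub x y : distq q L (fun i => W x i `^ p) (fun i => W y i `^ p) <=
    distq q [set: I]%SET (fun i => W x i `^ p) (fun i => W y i `^ p).
  rewrite /distq ge0_ler_powR ?nnegrE ?sumr_ge0 ?invr_ge0 //; try by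
    [move=> *; exact: powR_ge0 | lra].
  rewrite [leRHS](big_setID L) /= TL lerDl sumr_ge0 // => i _; exact: powR_ge0.
move=> /(_ (fun x y Ax Ay => le_trans (sub x y) (hD x y Ax Ay))).
apply: splitsW; first by rewrite leq_exp2l.
move=> x y Ax Ay hxy.
apply: le_trans (distq_setID [set: I]%SET L _ _ q1) _; rewrite TL; apply: lerD => //.
set J := _ :\: L.
apply: le_trans (distq_quasi_triangle J _ _ (fun i => W c i `^ p) q1) _.
rewrite ler_pdivlMr ?powR_gt0 //.
have off z : A z -> (2 ^+ k) `^ p^-1 * distq q J (fun i => W z i `^ p) (fun i => W c i `^ p) <=
    p * (b * (level_mass k z + level_mass k c)
    + (1 + 2 `^ p) * ((2 ^+ k) `^ (p0 / p) * E `^ p0 * H / b `^ (p0 - 1)))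
  + 2 * M / (al * 2 ^+ n0) `^ p^-1.
  move=> Az; apply: (distq_off_large_le (a := dW z c)) => //.
  - by move=> i; exact: WH.
  - by move=> i; exact: WH.
  - exact: dWE.
  - exact: WM.
  - exact: WM.
  - by move=> i; rewrite !inE andbT -ltNge.
have := off x Ax; have := off y Ay; rewrite /level_cost.
set u := (2 ^+ k) `^ p^-1; set Y := (1 + _) * _; set t := 2 * M / _.
set e := M / 2 ^+ k.
move=> hy hx.
have bp : 0 < p * b by rewrite mulr_gt0.
have my : p * b * level_mass k y <= p * b * (level_mass k x + e).
  by rewrite ler_pM2l // mass.
have mc : p * b * level_mass k c <= p * b * (level_mass k x + e).
  by rewrite ler_pM2l // mass.
have e0 : 0 <= p * b * e by rewrite mulr_ge0 ?(ltW bp) // divr_ge0 // ltW.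
rewrite -mulrA [(_ + _) * u]mulrC [u * (_ + _)]mulrDr.
rewrite (_ : 4 * _ = 4 * (2 * (p * b * level_mass k x + p * b * e) + (p * Y + t))).
  apply: (@lin_combine _ _ _ _ (p * b * level_mass k y) (p * b * level_mass k c)).
  - by apply: le_trans hx _; rewrite le_eqVlt; apply/orP; left; apply/eqP; ring.
  - by apply: le_trans hy _; rewrite le_eqVlt; apply/orP; left; apply/eqP; ring.
  - by rewrite -mulrDr.
  - by rewrite -mulrDr.
  - exact: e0.
by ring.
Qed.

End Level.

(** * Norms of complex vectors *)

Definition modulus (R : realType) (m : nat) (x : 'rV[R[i]]_m) (j : 'I_m) : R :=
  Normc.normc (x 0 j).

Lemma normc_ge0 (R : realType) (z : R[i]) : 0 <= Normc.normc z.
Proof. by case: z => a b /=; rewrite /Normc.normc sqrtr_ge0. Qed.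

Lemma normc_real (R : realType) (a : R) : Normc.normc a%:C%C = `|a|.
Proof. by rewrite /Normc.normc /= expr0n addr0 sqrtr_sqr. Qed.

Lemma modulus_dist (R : realType) (m : nat) (x y : 'rV[R[i]]_m) (j : 'I_m) :
  `|modulus x j - modulus y j| <= modulus (x - y) j.
Proof.
have tri (u v : R[i]) : Normc.normc u <= Normc.normc (u - v) + Normc.normc v.
  by rewrite -{1}(subrK v u); exact: le_normcD.
rewrite /modulus !mxE ler_norml.
have := tri (x 0 j) (y 0 j); have := tri (y 0 j) (x 0 j).
have -> : Normc.normc (y 0 j - x 0 j) = Normc.normc (x 0 j - y 0 j).
  by rewrite -[RHS]normcN opprB.
lra.
Qed.

Lemma ldist_Tp (R : realType) (m : nat) (p q : R) (x y : 'rV[R[i]]_m) :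
  ldist q%:E (\row_(j < m) (Normc.normc (x 0 j) `^ p)%:C%C)
    (\row_(j < m) (Normc.normc (y 0 j) `^ p)%:C%C) =
  distq q [set: 'I_m]%SET (fun j => modulus x j `^ p) (fun j => modulus y j `^ p).
Proof.
rewrite /ldist /lnorm /distq; congr (_ `^ _).
rewrite [RHS](eq_bigl xpredT); last by move=> j; rewrite inE.
by apply: eq_bigr => j _; rewrite !mxE -rmorphB normc_real.
Qed.

Lemma lnorm_pow (R : realType) (m : nat) (p : R) (x : 'rV[R[i]]_m) : 0 < p ->
  lnorm p%:E x `^ p = \sum_j modulus x j `^ p.
Proof.
move=> p0; rewrite /lnorm -powRrM mulVf ?gt_eqF // powRr1 // sumr_ge0 // => j _.
exact: powR_ge0.
Qed.

Lemma lnorm_ge0 (R : realType) (m : nat) (r : \bar R) (x : 'rV[R[i]]_m) :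
  0 <= lnorm r x.
Proof.
case: r => [r||] //=; first exact: powR_ge0.
by apply: (big_ind (fun z : R => 0 <= z)) => // [a c a0 _|j _]; rewrite ?le_max ?a0 ?normc_ge0.
Qed.

Lemma modulus_le_lnormy (R : realType) (m : nat) (x : 'rV[R[i]]_m) (j : 'I_m) :
  modulus x j <= lnorm +oo x.
Proof. by rewrite /lnorm /= (bigD1 j) //= le_max lexx. Qed.

(** Since 1/p1 = 1/p0 - 1/p, this is Hölder with exponent p1; for p0 = p it is the trivial bound by
    the sup norm. *)
Lemma lnorm_hoelder_bound (R : realType) (m : nat) (p p0 E : R)
    (z : 'rV[R[i]]_m) : 1 < p0 -> p0 <= p ->
  lnorm (exponent_p1 p p0) z <= E ->
  hoelder_bound (modulus z) E (p0^-1 - p^-1).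
Proof.
move=> p01 p0p; rewrite /exponent_p1; case: eqVneq => [->|ne] hE J t g t0 t1 g0.
  rewrite subrr mulr0 subr0 powRr1 ?sumr_ge0 // mulr_sumr.
  apply: ler_sum => j _; rewrite powRr1 // ler_wpM2r //.
  have hj := le_trans (modulus_le_lnormy z j) hE.
  rewrite ge0_ler_powR ?nnegrE ?normc_ge0 //.
  exact: le_trans (normc_ge0 _) hj.
have pp : 0 < p by lra.
have p0pos : 0 < p0 by lra.
have lt : 0 < p - p0 by rewrite subr_gt0 lt_neqAle ne.
move: hE; set r := p * p0 / (p - p0) => hE.
have r0 : 0 < r by rewrite divr_gt0 ?mulr_gt0.
have ipE : p0^-1 - p^-1 = r^-1.
  by rewrite /r; field; rewrite !gt_eqF.
rewrite ipE in t1 *.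
have th : 0 <= t * r^-1 <= 1 by rewrite t1 andbT divr_ge0 // ltW.
have := @hoelder_sum R 'I_m J (fun j => modulus z j `^ r) g (t * r^-1)
  (fun j => powR_ge0 _ _) g0 th.
rewrite (eq_bigr (fun j => modulus z j `^ t * g j `^ (1 - t * r^-1))); last first.
  by move=> j _; rewrite -powRrM mulrCA mulfV ?mulr1 // gt_eqF.
move=> h; apply: le_trans h _; rewrite ler_wpM2r ?powR_ge0 //.
rewrite mulrC powRrM ge0_ler_powR ?nnegrE ?powR_ge0 //.
  exact: le_trans (lnorm_ge0 _ z) hE.
apply: le_trans hE; rewrite /lnorm ge0_ler_powR ?invr_ge0 ?(ltW r0) ?nnegrE //.
- by apply: sumr_ge0 => j _; exact: powR_ge0.
- by apply: sumr_ge0 => j _; exact: powR_ge0.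
rewrite [leRHS](bigID (mem J)) /= lerDl sumr_ge0 // => j _; exact: powR_ge0.
Qed.

(** * Blocks of a partition and their diameters *)

Lemma pblock_mem (X : Type) (T : set X) (P : set (set X)) (x : X) :
  partition P id T -> T x -> P (pblock P id x) /\ pblock P id x x.
Proof.
move=> [cov _ _] Tx; have [B PB Bx] : cover P id x by rewrite cov.
have [] := @getPex _ [set B | P B /\ B x]; last by [].
by exists B.
Qed.

Lemma splits_pblock (X : Type) (T A : set X) (P : set (set X)) (N : nat) :
  partition P id T -> (P #<= `I_N)%card -> A `<=` T ->
  splits A N (fun x y => pblock P id x = pblock P id y).
Proof.
move=> part /pcard_leP[f] AT.
exists (fun x => f (pblock P id x)) => [x Ax|x y Ax Ay].
  by have [Px _] := pblock_mem part (AT x Ax); exact: (@funS _ _ _ _ f _ Px).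
have [Px _] := pblock_mem part (AT x Ax).
have [Py _] := pblock_mem part (AT y Ay).
by apply: (@inj _ _ _ f); rewrite inE.
Qed.

Lemma diam_fin_num (R : realType) (X : Type) (A : set X) (d : X -> X -> R) (D : R) :
  A !=set0 -> (forall x y, A x -> A y -> d x y <= D) -> diam A d \is a fin_num.
Proof.
move=> [x Ax] h; rewrite fin_numE; apply/andP; split.
  apply/eqP => e; have : ((d x x)%:E <= diam A d)%E.
    by apply: ereal_sup_ubound; exists x => //; exists x.
  by rewrite e.
apply/eqP => e; have : (diam A d <= D%:E)%E.
  by apply: ge_ereal_sup => _ [u Au [v Av <-]]; rewrite lee_fin h.
by rewrite e.
Qed.

Lemma le_fine_diam (R : realType) (X : Type) (A : set X) (d : X -> X -> R)
    (D : R) (x y : X) :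
  (forall x y, A x -> A y -> d x y <= D) -> A x -> A y ->
  d x y <= fine (diam A d).
Proof.
move=> h Ax Ay; rewrite -lee_fin fineK ?(@diam_fin_num _ _ _ _ D) //; last by exists x.
by apply: ereal_sup_ubound; exists x => //; exists y.
Qed.

(** * Summation over the levels *)

Lemma sum_nat_range_le (R : realType) (F : nat -> R) (a c d : nat) :
  (forall j, 0 <= F j) -> (c <= d)%N ->
  \sum_(a <= j < c) F j <= \sum_(0 <= j < d) F j.
Proof.
move=> F0 cd; have [ac|ca] := leqP a c; last first.
  by rewrite big_geq ?(ltnW ca) // sumr_ge0.
rewrite (@big_cat_nat _ _ _ c 0 d) //= (@big_cat_nat _ _ _ a 0 c) //=.
by rewrite -addrA addrCA lerDl addr_ge0 // sumr_ge0.
Qed.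

Lemma sum_dyadic_le (R : realType) (M : R) (a n : nat) : 0 <= M ->
  \sum_(a <= k < n) M / 2 ^+ k <= 2 * M.
Proof.
move=> M0; apply: le_trans (sum_nat_range_le a _ (leqnn n)) _.
  by move=> j; rewrite divr_ge0.
have -> : \sum_(0 <= k < n) M / 2 ^+ k = 2 * M - 2 * (M / 2 ^+ n).
  elim: n => [|n IH]; first by rewrite big_nil expr0; field.
  by rewrite big_nat_recr //= IH exprS; field; rewrite expf_neq0.
by rewrite gerBl mulr_ge0 // divr_ge0.
Qed.

Lemma sum_ltn_le (R : realType) (K0 K1 n : nat) :
  \sum_(K0 <= k < n) ((k < K1)%N)%:R <= (K1 - K0)%:R :> R.
Proof.
rewrite -natr_sum ler_nat -big_mkcond /= sum1_count -size_filter.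
apply: (@leq_trans (size (iota K0 (K1 - K0)))); last by rewrite size_iota.
apply: uniq_leq_size; first by rewrite filter_uniq // iota_uniq.
move=> k; rewrite mem_filter mem_index_iota mem_iota => /andP[h1 /andP[h2 _]].
by rewrite h2 subnKC // (leq_trans h2 (ltnW h1)).
Qed.

(** The rounded logarithm satisfies 2^(K1-1) < 24m, so if K0 < K1 then 2^(K1-K0) < 48m / (64 m0) < m
    / m0. The slack in 64 prevents an additive constant, which ln(m / m0) could not absorb when m is
    close to m0. *)
Lemma middle_level_count (R : realType) (m m0 K0 : nat) :
  (0 < m0)%N -> (m0 < m)%N -> (64 * m0 <= 2 ^ K0)%N ->
  (up_log 2 (24 * m) - K0)%:R * ln 2 <= ln (m%:R / m0%:R) :> R.
Proof.
move=> m00 m0m hK; set K1 := up_log 2 (24 * m).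
have m0R : 0 < m0%:R :> R by rewrite ltr0n.
have mR : 0 < m%:R :> R by rewrite ltr0n (leq_trans _ m0m).
have m24 : (1 < 24 * m)%N by lia.
have /andP[h1 _] := up_log_bounds (isT : (1 < 2)%N) m24; rewrite -/K1 in h1.
have q1 : 1 <= m%:R / m0%:R :> R by rewrite ler_pdivlMr // mul1r ler_nat ltnW.
have [K10|K01] := leqP K1 K0.
  by rewrite (eqP (_ : K1 - K0 == 0)%N) ?mul0r ?ln_ge0 // subn_eq0.
rewrite mulr_natl -lnXn // ler_ln ?posrE ?exprn_gt0 ?divr_gt0 //.
rewrite ler_pdivlMr // -natrX -natrM ler_nat.
have e : (2 ^ K1.-1 = 2 ^ K0 * 2 ^ (K1 - K0).-1)%N.
  by rewrite -expnD; congr (_ ^ _)%N; lia.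
have e2 : (2 ^ (K1 - K0) = 2 * 2 ^ (K1 - K0).-1)%N.
  by rewrite -expnS prednK // subn_gt0.
rewrite e2; move: h1; rewrite e; move: (2 ^ (K1 - K0).-1)%N => z h1.
have : (64 * m0 * z < 24 * m)%N by apply: leq_ltn_trans h1; rewrite leq_mul2r hK orbT.
by rewrite -mulnA [(m0 * z)%N]mulnC; lia.
Qed.

(** The masses lie in [0, M]; they are rounded down to multiples of M / 2^k, which takes 2^k + 1
    labels. *)
Lemma splits_level_mass (R : realType) (I : finType) (X : Type) (A : set X)
    (W : X -> I -> R) (p b M al : R) (n0 k : nat) : 0 < M ->
  (forall x, A x -> \sum_i W x i `^ p <= M) ->
  splits A (2 ^ k).+1 (fun x y =>
    level_mass W p b M al n0 k x <= level_mass W p b M al n0 k y + M / 2 ^+ k).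
Proof.
move=> M0 WM; pose f x := level_mass W p b M al n0 k x.
have K0 : 0 < 2 ^+ k / M :> R by rewrite divr_gt0 ?exprn_gt0.
have f0 x : 0 <= f x by exact: window_mass_ge0.
have fK x : 0 <= f x * (2 ^+ k / M) by rewrite mulr_ge0 // ltW.
have fM x : A x -> f x <= M.
  move=> Ax; apply: le_trans (WM x Ax); rewrite /f /level_mass /window_mass.
  rewrite [leRHS](bigID (fun i => lo_level (2 ^+ k) M al (2 ^+ n0) <= W x i `^ p
    < hi_level p (2 ^+ k) b M al)) /=.
  by rewrite lerDl sumr_ge0 // => i _; exact: powR_ge0.
exists (fun x => Num.truncn (f x * (2 ^+ k / M))) => [x Ax|x y Ax Ay e].
  have /andP[h _] := truncn_itv (fK x).
  rewrite ltnS -(ler_nat R); apply: le_trans h _; rewrite natrX.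
  by apply: le_trans (ler_wpM2r (ltW K0) (fM x Ax)) _; rewrite mulrCA divff ?mulr1 ?gt_eqF.
have /andP[_ h1] := truncn_itv (fK x); have /andP[h2 _] := truncn_itv (fK y).
rewrite -/(f x) -/(f y) -(ler_pM2r K0) mulrDl.
have -> : M / 2 ^+ k * (2 ^+ k / M) = 1 by field; rewrite !gt_eqF ?exprn_gt0.
by move: h1; rewrite e -natr1; lra.
Qed.

(** The budget 2^k is spent as 2^(k-2) on the given partition, 2^(k-2) on the mass classes and
    2^(k-1) on the grid. The mass classes need k + 1 <= 2^(k-2), hence the lower bound on k. *)
Lemma level_label_count k : (6 <= k)%N ->
  (Nadm (k - 2) * (2 ^ k).+1 * 2 ^ (2 ^ k.-1) <= 2 ^ (2 ^ k))%N.
Proof.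
move=> k6; have -> : Nadm (k - 2) = (2 ^ (2 ^ (k - 2)))%N.
  by rewrite /Nadm; case: (k - 2)%N (ltac:(lia) : (0 < k - 2)%N).
have e1 : (2 ^ k = 2 ^ (k - 2) + 2 ^ (k - 2) + 2 ^ k.-1)%N.
  have [j ->] : exists j, k = j.+2 by exists (k - 2)%N; lia.
  by rewrite (_ : j.+2 - 2 = j)%N /= ?expnS; lia.
rewrite [leqRHS](congr1 (expn 2) e1) !expnD leq_mul2r leq_mul2l; apply/orP; right.
apply/orP; right; apply: (@leq_trans (2 ^ k.+1)).
  by rewrite expnS mul2n -addnn -addn1 leq_add2l expn_gt0.
rewrite leq_exp2l //.
have [j ->] : exists j, k = (6 + j)%N by exists (k - 6)%N; lia.
have -> : (6 + j - 2 = 4 + j)%N by lia.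
elim: j => // j IH; rewrite !addnS expnS; lia.
Qed.

(** The three parts of the cost are summed separately: masses by the window count, diameters by the
    chaining sum of the given partitions shifted by two levels, and the constant tail term by the
    number of levels below [K1]. *)
Lemma sum_level_cost_le (R : realType) (I : finType) (X : Type)
    (W : X -> I -> R) (p p0 b H M al Ga : R) (n0 J K0 K1 n : nat)
    (e : nat -> R) (x : X) :
  1 <= p -> 0 <= p0 -> p0 <= p -> 0 < b -> 0 <= H -> 0 < M -> 0 < al ->
  (2 <= K0)%N -> Num.max 1 (al * b `^ p) <= 2 ^+ J ->
  (forall i, 0 <= W x i) -> \sum_i W x i `^ p <= M ->
  (forall j, 0 <= e j) ->
  (forall n, \sum_(0 <= j < n) (2 `^ (j%:R / p) * e j) `^ p0 <= Ga) ->
  \sum_(K0 <= k < n)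
     (if (k < K1)%N then level_cost W p p0 b H M al n0 k (e (k - 2)%N) x else 0) <=
  8 * (p * b) * ((n0 + J)%:R * M + 2 * M)
  + 16 * (p * (1 + 2 `^ p)) * (Ga * H / b `^ (p0 - 1))
  + (K1 - K0)%:R * (8 * (M / (al * 2 ^+ n0) `^ p^-1)).
Proof.
move=> p1 p00 p0p b0 H0 M0 al0 K02 hJ W0 WM e0 hGa.
have pp : 0 < p by lra.
pose Hb := H / b `^ (p0 - 1).
have Hb0 : 0 <= Hb by rewrite divr_ge0 ?powR_ge0.
pose F j := (2 `^ (j%:R / p) * e j) `^ p0.
have F0 j : 0 <= F j by exact: powR_ge0.
pose t := M / (al * 2 ^+ n0) `^ p^-1.
have t0 : 0 <= t by rewrite divr_ge0 ?powR_ge0 // ltW.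
pose c2 := 16 * (p * (1 + 2 `^ p)).
have c20 : 0 <= c2 by rewrite !mulr_ge0 ?addr_ge0 ?powR_ge0 // ltW.
have pb0 : 0 <= 8 * (p * b) by rewrite !mulr_ge0 // ltW.
pose mass k := level_mass W p b M al n0 k x.
have mass0 k : 0 <= mass k by exact: window_mass_ge0.
have term k : (K0 <= k)%N ->
    (if (k < K1)%N then level_cost W p p0 b H M al n0 k (e (k - 2)%N) x else 0) <=
    8 * (p * b) * (mass k + M / 2 ^+ k) + c2 * (F (k - 2)%N * Hb)
      + (k < K1)%N%:R * (8 * t).
  move=> kK; have h0 : 0 <= mass k + M / 2 ^+ k.
    by rewrite addr_ge0 // divr_ge0 // ltW.
  case: ifP => _; last first.
    rewrite mul0r addr0; apply: addr_ge0; apply: mulr_ge0 => //.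
    exact: mulr_ge0.
  rewrite mul1r /level_cost -/(mass k).
  (* Passing from level k - 2 to level k multiplies the weight by 4^(p0/p) <= 4. *)
  have hF : (2 ^+ k) `^ (p0 / p) * e (k - 2)%N `^ p0 <= 4 * F (k - 2)%N.
    rewrite /F powRM ?powR_ge0 // mulrA ler_wpM2r ?powR_ge0 // -powRrM.
    have {1}-> : k = (2 + (k - 2))%N by rewrite subnKC // (leq_trans K02).
    rewrite exprD powRM ?exprn_ge0 // ler_pM ?powR_ge0 //.
      rewrite -[leRHS](@powRr1 R 4) // (_ : 2 ^+ 2 = 4); last by ring.
      by rewrite ler_powR ?ler1n // ler_pdivrMr ?mul1r.
    rewrite -powR_mulrn // -powRrM le_eqVlt; apply/orP; left; apply/eqP.
    by congr (_ `^ _); field; rewrite gt_eqF.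
  have hY : (1 + 2 `^ p) * ((2 ^+ k) `^ (p0 / p) * e (k - 2)%N `^ p0 * H / b `^ (p0 - 1))
      <= (1 + 2 `^ p) * (4 * (F (k - 2)%N * Hb)).
    rewrite ler_wpM2l ?addr_ge0 ?powR_ge0 // [leRHS]mulrA.
    by rewrite (le_trans _ (ler_wpM2r Hb0 hF)) // /Hb mulrA.
  have := ler_wpM2l (ltW pp) hY.
  rewrite /c2 -/t; have -> : 2 * M / (al * 2 ^+ n0) `^ p^-1 = 2 * t by rewrite /t mulrA.
  set y1 := (1 + _) * _; set m1 := mass k + _ => hy.
  have E1 : 16 * (p * (1 + 2 `^ p)) * (F (k - 2)%N * Hb) =
     4 * (p * ((1 + 2 `^ p) * (4 * (F (k - 2)%N * Hb)))) by ring.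
  have E2 : 4 * (p * (b * (2 * m1) + y1) + 2 * t) = 8 * (p * b) * m1 + 4 * (p * y1) + 8 * t.
    by ring.
  by rewrite E1 E2 lerD2r lerD2l ler_pM2l.
apply: le_trans (_ : \sum_(K0 <= k < n) (8 * (p * b) * (mass k + M / 2 ^+ k) +
   c2 * (F (k - 2)%N * Hb) + (k < K1)%N%:R * (8 * t)) <= _).
  by apply: ler_sum_nat => k /andP[kK _]; exact: term.
rewrite !big_split /= -!mulr_sumr -!mulr_suml big_split /=.
apply: lerD; first apply: lerD.
- rewrite ler_wpM2l //; apply: lerD; last by rewrite sum_dyadic_le // ltW.
  exact: window_mass_sum_le.
- rewrite ler_wpM2l // -[leRHS]mulrA -/Hb ler_wpM2r //.
  have -> : K0 = (K0 - 2 + 2)%N by rewrite subnK.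
  rewrite big_addn (eq_bigr F); last by move=> k _; rewrite addnK.
  by apply: le_trans (hGa n); rewrite sum_nat_range_le // leq_subr.
- by apply: ler_wpM2r; [rewrite mulr_ge0 | exact: sum_ltn_le].
Qed.

(** Collected coefficients: 130 = 2 + 128 from the initial diameter, 256 = 64 + 192 and 64 from the
    window masses, 128 = 8 * 16 from the chaining sum, 3072 = 8 * 8 * 48 from the tails. *)
Definition chaining_constant (R : realType) (p : R) : R :=
  130 * (((2 `^ p^-1 - 1)^-1 + 2) * p) + 256 * p + 64 * p ^+ 2
  + 128 * (p * (1 + 2 `^ p)) + 3072 / ln 2.

Lemma le_weighted_sum5 (R : realDomainType) (a p s v l : R) :
  0 <= a -> 0 <= p -> 0 <= s -> 0 <= v -> 0 <= l ->
  [/\ 2 * a + 256 * p <= 130 * a + 256 * p + 64 * s + 128 * v + 3072 * l,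
      64 * s <= 130 * a + 256 * p + 64 * s + 128 * v + 3072 * l,
      3072 * l <= 130 * a + 256 * p + 64 * s + 128 * v + 3072 * l,
      128 * a <= 130 * a + 256 * p + 64 * s + 128 * v + 3072 * l &
      128 * v <= 130 * a + 256 * p + 64 * s + 128 * v + 3072 * l].
Proof. by move=> *; split; lra. Qed.

(** Bare multiples of b M are absorbed into b n0 M because n0 >= 1; the rest compares
    coefficients. *)
Lemma le_chaining_constant (R : realType) (p b n0 be M Z1 Z2 L : R) :
  2 <= p -> 0 <= b -> 1 <= n0 -> 0 <= be -> 0 <= M -> 0 <= Z1 -> 0 <= Z2 -> 0 <= L ->
  ((2 `^ p^-1 - 1)^-1 + 2) * (p * (b * (2 * M) + 128 * Z1))
  + 8 * (8 * (p * b) * ((n0 + (p * (b * be) + 1)) * M + 2 * M)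
        + 16 * (p * (1 + 2 `^ p)) * Z2 + L / ln 2 * (8 * (48 * M)))
  <= chaining_constant p * ((b * n0 + b ^+ 2 * be + L) * M + (Z1 + Z2)).
Proof.
move=> p2 b0 n1 be0 M0 Z10 Z20 L0.
have pp : 0 <= p by lra.
have p1 : 1 <= p by lra.
rewrite /chaining_constant.
have := powR2_inv_gt1 p1; set u := 2 `^ p^-1; move=> u1.
have u0 : 0 <= (u - 1)^-1 + 2 by rewrite addr_ge0 // invr_ge0; lra.
have v0 : 0 <= p * (1 + 2 `^ p) by rewrite mulr_ge0 // addr_ge0 // powR_ge0.
have l0 : 0 <= (ln 2)^-1 :> R by rewrite invr_ge0 ln_ge0 // ler1n.
move: u0 v0 l0; set A := ((u - 1)^-1 + 2); set V := p * (1 + 2 `^ p); set l := (ln 2)^-1.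
move=> u0 v0 l0.
have Ap : 0 <= A * p by rewrite mulr_ge0.
have pp2 : 0 <= p ^+ 2 by rewrite exprn_ge0.
set C := _ + 3072 * l.
have [C1 C2 C3 C4 C5] : [/\ 2 * (A * p) + 256 * p <= C, 64 * p ^+ 2 <= C,
    3072 * l <= C, 128 * (A * p) <= C & 128 * V <= C].
  exact: le_weighted_sum5.
have bM : 0 <= b * M by rewrite mulr_ge0.
have bnM : b * M <= b * n0 * M.
  by rewrite -mulrA [n0 * M]mulrC mulrA ler_peMr.
have bnM0 : 0 <= b * n0 * M by apply: le_trans bnM.
apply: le_trans (_ : (2 * (A * p) + 256 * p) * (b * n0 * M) + 64 * p ^+ 2 * (b ^+ 2 * be * M)
  + 3072 * l * (L * M) + 128 * (A * p) * Z1 + 128 * V * Z2 <= _).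
  have -> : A * (p * (b * (2 * M) + 128 * Z1)) +
     8 * (8 * (p * b) * ((n0 + (p * (b * be) + 1)) * M + 2 * M) + 16 * V * Z2 + L * l * (8 * (48 * M))) =
     2 * (A * p) * (b * M) + 64 * p * (b * n0 * M) + 192 * p * (b * M)
      + 64 * p ^+ 2 * (b ^+ 2 * be * M)
      + 3072 * l * (L * M) + 128 * (A * p) * Z1 + 128 * V * Z2 by ring.
  rewrite !lerD2r mulrDl.
  have h1 : 2 * (A * p) * (b * M) <= 2 * (A * p) * (b * n0 * M).
    by rewrite ler_wpM2l // mulr_ge0.
  have h2 : 192 * p * (b * M) <= 192 * p * (b * n0 * M).
    by rewrite ler_wpM2l // mulr_ge0.
  lra.
have -> : C * ((b * n0 + b ^+ 2 * be + L) * M + (Z1 + Z2)) =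
  C * (b * n0 * M) + C * (b ^+ 2 * be * M) + C * (L * M) + C * Z1 + C * Z2 by ring.
by rewrite !lerD // ler_wpM2r // !mulr_ge0.
Qed.

(** * The bound for a given admissible sequence *)

(** The contraction lemma is applied to T_p(G), starting at a level with 2^K0 comparable to m0. The
    initial diameter yields the diameter term, and the summed level costs yield the rest. *)
Lemma gamma_Tp_le (R : realType) (p p0 : R) (m : nat) (G : set 'rV[R[i]]_m)
    (b alpha0 M H DG Ga : R) (n0 m0 : nat) (A : nat -> set (set 'rV[R[i]]_m)) :
  2 <= p -> 1 < p0 -> p0 <= p -> G !=set0 ->
  0 < b -> 0 < alpha0 -> alpha0 < 1 -> (1 <= n0)%N -> (1 <= m0)%N -> (m0 < m)%N ->
  0 < M -> 0 <= H ->
  (forall x, G x -> lnorm p%:E x `^ p <= M) ->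
  (forall x, G x -> lnorm +oo x `^ (p - p0) <= H) ->
  (forall x y, G x -> G y -> ldist (exponent_p1 p p0) x y <= DG) ->
  admissible G A ->
  (forall x, G x -> (\sum_(0 <= n <oo) ((2 `^ (n%:R / p))%R%:E *
      diam (pblock (A n) id x) (ldist (exponent_p1 p p0))) `^ p0 <= Ga%:E)%E) ->
  (gamma p 1 (Tp p G) (ldist (conjugate_exponent p)%:E) <=
    (chaining_constant p * ((b * n0%:R + b ^+ 2 * alpha0 `^ p^-1
       + ln (m%:R / m0%:R) / (2 ^+ n0 * alpha0) `^ p^-1) * M
     + H * ((m0%:R `^ (p0 / p) * DG `^ p0 + Ga) * (b `^ (p0 - 1))^-1)))%:E)%E.
Proof.
move=> p2 p01 p0p [x0 Gx0] b0 a0 a1 n01 m01 m0m M0 H0 GM GH GD admA hGa.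
have p1 : 1 <= p by lra.
have pp : 0 < p by lra.
have p0pos : 0 < p0 by lra.
pose q := conjugate_exponent p.
have q1 : 1 <= q by rewrite /q /conjugate_exponent ler_pdivlMr; lra.
pose W (x : 'rV[R[i]]_m) := modulus x.
pose dW (x y : 'rV[R[i]]_m) := modulus (x - y).
pose tp (x : 'rV[R[i]]_m) := (\row_(i < m) (Normc.normc (x 0 i) `^ p)%:C%C)%R.
pose dist (x y : 'rV[R[i]]_m) :=
  distq q [set: 'I_m]%SET (fun i => W x i `^ p) (fun i => W y i `^ p).
have W0 x i : 0 <= W x i by exact: normc_ge0.
have WdW x y i : `|W x i - W y i| <= dW x y i by exact: modulus_dist.
have WM x : G x -> \sum_i W x i `^ p <= M by move=> Gx; rewrite -lnorm_pow // GM.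
have WH x i : G x -> W x i `^ (p - p0) <= H.
  move=> Gx; apply: le_trans (GH x Gx); rewrite ge0_ler_powR ?nnegrE ?subr_ge0 //.
    exact: lnorm_ge0.
  exact: modulus_le_lnormy.
have dWE x y E : ldist (exponent_p1 p p0) x y <= E -> hoelder_bound (dW x y) E (p0^-1 - p^-1).
  by move=> hE; apply: lnorm_hoelder_bound.
have DG0 : 0 <= DG by apply: le_trans (GD _ _ Gx0 Gx0); exact: lnorm_ge0.
(* This factor leaves at most [2 ^ k / 24] coordinates for the grid of level [k]. *)
pose al := alpha0 / (24 * 2 `^ p).
have tp0 : 0 < 2 `^ p :> R by rewrite powR_gt0.
have al0 : 0 < al by rewrite divr_gt0 // mulr_gt0.
have al24 : 24 * (2 `^ p * al) <= 1.
  by rewrite (_ : _ * _ = alpha0) ?(ltW a1) // /al; field; rewrite gt_eqF.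
have ala : al <= alpha0.
  rewrite ler_pdivrMr ?mulr_gt0 // ler_peMr ?(ltW a0) //.
  have : 1 <= 2 `^ p :> R by rewrite -[leLHS](@powRr0 R 2) ler_powR ?ler1n // ltW.
  lra.
have [J hJ Jle] := pow2_exponent p1 (ltW b0) (ltW al0).
(* Thus 64 m0 <= 2^K0 <= 128 m0: the lower bound serves the level count, the upper one the initial
   diameter, and K0 >= 7 the label budget. *)
pose K0 := (trunc_log 2 m0 + 7)%N.
have /andP[tl1 tl2] := trunc_log_bounds (isT : (1 < 2)%N) m01.
have K0lo : (64 * m0 <= 2 ^ K0)%N.
  rewrite /K0 addnC (_ : 7 = 6 + 1)%N // -addnA add1n expnD leq_mul // ltnW //.
have K0hi : (2 ^ K0 <= 128 * m0)%N by rewrite /K0 addnC expnD leq_mul.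
have K07 : (7 <= K0)%N by rewrite /K0 leq_addl.
pose K1 := up_log 2 (24 * m).
pose d1 := @ldist R m (exponent_p1 p p0).
pose e x (j : nat) := fine (diam (pblock (A j) id x) d1).
have partA j : partition (A j) id G by have [] := admA j.
have blockG j x : G x -> pblock (A j) id x `<=` G.
  move=> Gx y By; have [Px _] := pblock_mem (partA j) Gx.
  have [cov _ _] := partA j; rewrite -cov; by exists (pblock (A j) id x).
have eD j x y z : G x -> pblock (A j) id x y -> pblock (A j) id x z -> d1 y z <= e x j.
  move=> Gx; apply: le_fine_diam => u v /(blockG _ _ Gx) Gu /(blockG _ _ Gx) Gv.
  exact: GD.
have blockx j x : G x -> pblock (A j) id x x by move=> Gx; have [] := pblock_mem (partA j) Gx.
have e0 x j : G x -> 0 <= e x j.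
  move=> Gx; apply: le_trans (eD j x x x Gx _ _); try exact: blockx.
  exact: lnorm_ge0.
have eGa x n : G x -> \sum_(0 <= j < n) (2 `^ (j%:R / p) * e x j) `^ p0 <= Ga.
  move=> Gx; rewrite -lee_fin; apply: le_trans (hGa x Gx).
  apply: le_trans (nneseries_lim_ge n _); last first.
    by move=> j _ _; exact: poweR_ge0.
  rewrite -sumEFin; apply: lee_sum => j _.
  rewrite (_ : (_ `^ p0)%:E = ((2 `^ (j%:R / p))%:E * (e x j)%:E) `^ p0)%E; last first.
    by rewrite -EFinM poweR_EFin.
  rewrite fineK // (@diam_fin_num _ _ _ _ DG) //.
    by exists x; exact: blockx.
  by move=> u v /(blockG _ _ Gx) Gu /(blockG _ _ Gx) Gv; exact: GD.
(* T_p forgets phases, so a preimage in G is chosen for each of its points in order to carry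
   partitions and errors over to T_p(G). *)
have /choice[g gP] : forall u, exists x, Tp p G u -> G x /\ tp x = u.
  move=> u; have [[x Gx <-]|nu] := pselect (Tp p G u); first by exists x.
  by exists u.
pose S k x := if (k < K1)%N
  then level_cost W p p0 b H M al n0 k (e x (k - 2)%N) x / (2 ^+ k) `^ p^-1
  else 0.
pose Z1 := m0%:R `^ (p0 / p) * DG `^ p0 * H / b `^ (p0 - 1).
(* Interpolation on all of G at K = 2^K0; the factor 128 in front of [Z1] comes from (128 m0)^(p0/p)
   <= 128 m0^(p0/p). *)
pose D := p * (b * (2 * M) + 128 * Z1) / (2 ^+ K0) `^ p^-1.
have ldistE u v : Tp p G u -> Tp p G v -> ldist q%:E u v = dist (g u) (g v).
  move=> Tu Tv; rewrite -{1}(gP u Tu).2 -{1}(gP v Tv).2; exact: ldist_Tp.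
have K0R : 0 < 2 ^+ K0 :> R by rewrite exprn_gt0.
have distD x y : G x -> G y -> dist x y <= D.
  move=> Gx Gy; rewrite /D ler_pdivlMr ?powR_gt0 // mulrC.
  have := distq_interpolation (2 ^+ K0) p2 p01 p0p b0 DG0 H0 (W0 x) (W0 y) (WdW x y)
    (fun i => WH x i Gx) (fun i => WH y i Gy) (dWE x y DG (GD x y Gx Gy)) [set: 'I_m]%SET.
  move=> h; apply: le_trans h _; rewrite ler_pM2l //; apply: lerD.
    rewrite ler_pM2l // (_ : 2 * M = M + M); last by ring.
    apply: le_trans (lerD (WM x Gx) (WM y Gy)).
    rewrite -big_split /= [leLHS](eq_bigl xpredT); last by move=> i; rewrite inE.
    apply: ler_sum => i _; rewrite maxEle.
    by case: ifP => _; rewrite ?lerDl ?lerDr powR_ge0.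
  rewrite /Z1 !mulrA ler_pM2r ?invr_gt0 ?powR_gt0 // ler_wpM2r // ler_wpM2r ?powR_ge0 //.
  have pr : 0 <= p0 / p by rewrite divr_ge0 // ltW.
  have h1 : (2 ^+ K0 : R) <= 128 * m0%:R by rewrite -natrX -natrM ler_nat.
  apply: le_trans (ge0_ler_powR pr _ _ h1) _; rewrite ?nnegrE ?mulr_ge0 ?(ltW K0R) //.
  rewrite powRM // ler_wpM2r ?powR_ge0 // -[leRHS](@powRr1 R 128) //.
  by rewrite ler_powR ?ler1n // ler_pdivrMr // mul1r.
have step k A' D' : (K0 <= k)%N -> A' `<=` G ->
    (forall x y, A' x -> A' y -> dist x y <= D') ->
    splits A' (2 ^ (2 ^ k)) (fun x y => dist x y <= D' / 4 + S k x /\ S k x <= 2 * S k y).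
  move=> kK AG hD'; have [kK1|K1k] := ltnP k K1; last first.
    (* From [K1] on, a grid in all m coordinates fits the label budget and leaves no error. *)
    have J12 : (12 * #|[set: 'I_m]%SET| <= 2 ^ k)%N.
      rewrite cardsT card_ord.
      have m24 : (1 < 24 * m)%N.
        by rewrite (@leq_trans (24 * 1)) // leq_mul2l (leq_trans m01 (ltnW m0m)).
      have /andP[_ h2] := up_log_bounds (isT : (1 < 2)%N) m24.
      apply: leq_trans (leq_trans h2 (leq_pexp2l (isT : (0 < 2)%N) K1k)).
      by rewrite leq_mul2r orbT.
    have := @splits_distq R 'I_m _ A' (fun x i => W x i `^ p) q [set: 'I_m]%SET D' q1 hD'.
    apply: splitsW; first by rewrite leq_exp2l.
    by move=> x y _ _ h; rewrite /S ltnNge K1k /= addr0 mulr0.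
  have k6 : (6 <= k)%N by apply: leq_trans kK; apply: leq_trans K07.
  have [_ cardA _] := admA (k - 2)%N.
  have AM x : A' x -> \sum_i W x i `^ p <= M by move=> /AG; exact: WM.
  (* The cell is cut by the block of the partition of level k - 2, then by level mass, and finally
     by the grid on the large coordinates. *)
  have s1 := splits_refine (splits_pblock (partA (k - 2)%N) cardA AG)
    (fun B (BA : B `<=` A') _ => @splits_level_mass R 'I_m _ B W p b M al n0 k M0 (fun x Bx => AM x (BA x Bx))).
  have s2 := splits_refine s1 (N2 := (2 ^ (2 ^ k.-1))%N)
    (E2 := fun x y => dist x y <= D' / 4 + S k x).
  apply: splitsW (level_label_count k6) _ (s2 _) => [x y Ax Ay [[h1 h2] h3]|B BA hB].
    split; first exact: h3.
    have iK : 0 < ((2 ^+ k) `^ p^-1)^-1 :> R by rewrite invr_gt0 powR_gt0 // exprn_gt0.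
    rewrite /S kK1 mulrA (ler_pM2r iK) /e h1.
    exact: (level_cost_le p0 p2 b0 H0 M0 _ h2).
  have [[c Bc]|B0] := pselect (B !=set0); last first.
    apply: splits1; first by rewrite expn_gt0.
    by move=> x y Bx; case: B0; exists x.
  have Gc := AG _ (BA _ Bc).
  have cell x : B x -> pblock (A (k - 2)%N) id c x.
    move=> Bx; have [[-> _]] := hB c x Bc Bx; exact/blockx/AG/BA.
  have := @splits_level R 'I_m _ W dW p p0 b H M al n0 p2 p01 p0p b0 H0 M0 al0 al24
    B k (e c (k - 2)%N) D' (leq_trans (isT : 0 < 6)%N k6) (e0 _ _ Gc) W0.
  move=> /(_ (fun x Bx => AM x (BA x Bx)) (fun x i Bx => WH x i (AG _ (BA x Bx))) WdW).
  move=> /(_ (fun x y Bx By => dWE _ _ _ (eD _ _ _ _ Gc (cell x Bx) (cell y By)))).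
  move=> /(_ (fun x y Bx By => (hB x y Bx By).2)).
  move=> /(_ (fun x y Bx By => hD' x y (BA x Bx) (BA y By))).
  apply: splitsW => // x y Bx By; rewrite /S kK1.
  by have [[h _]] := hB c x Bc Bx; rewrite /e h.
pose L := ln (m%:R / m0%:R) / (2 ^+ n0 * alpha0) `^ p^-1.
pose Z2 := Ga * H / b `^ (p0 - 1).
pose B := 8 * (p * b) * ((n0 + J)%:R * M + 2 * M) + 16 * (p * (1 + 2 `^ p)) * Z2
  + (K1 - K0)%:R * (8 * (M / (al * 2 ^+ n0) `^ p^-1)).
have main := @gamma_le_contraction R _ (Tp p G) (ldist q%:E) p K0 D B (fun k u => S k (g u)) p1.
apply: le_trans (main _ _ _ _) _.
- by exists (tp x0); exists x0.
- move=> u v Tu Tv; rewrite ldistE // distq_ge0 distD //.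
    by have [] := gP u Tu.
  by have [] := gP v Tv.
- move=> k T' D' kK T'T hD'.
  have [||l lN lE] := step k (g @` T') D' kK.
  + by move=> _ [u /T'T/gP[] ? _ <-].
  + by move=> _ _ [u Tu <-] [v Tv <-]; rewrite -ldistE ?hD' //; exact: T'T.
  exists (fun u => l (g u)) => [u Tu|u v Tu Tv luv]; first by apply: lN; exists u.
  rewrite ldistE; [|exact: T'T|exact: T'T].
  exact: (lE _ _ (imageP g Tu) (imageP g Tv) luv).
- move=> u n Tu; have [Gx _] := gP u Tu; set x := g u in Gx *.
  have := @sum_level_cost_le R 'I_m _ W p p0 b H M al Ga n0 J K0 K1 n (e x) x p1
    (ltW p0pos) p0p b0 H0 M0 al0 (leq_trans (isT : 2 <= 7)%N K07) hJ (W0 x) (WM x Gx)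
    (e0 x ^~ Gx) (eGa x ^~ Gx).
  apply: le_trans; rewrite le_eqVlt; apply/orP; left; apply/eqP.
  apply: eq_bigr => k _; rewrite /S; case: ifP => _; last by rewrite mulr0.
  have -> : 2 `^ (k%:R / p) = (2 ^+ k) `^ p^-1 :> R by rewrite powRrM powR_mulrn.
  by rewrite mulrCA mulfV ?mulr1 // gt_eqF // powR_gt0 // exprn_gt0.
rewrite lee_fin.
have Ga0 : 0 <= Ga by have := eGa x0 0%N Gx0; rewrite big_nil.
have Z10 : 0 <= Z1 by rewrite /Z1 !mulr_ge0 ?invr_ge0 ?powR_ge0.
have Z20 : 0 <= Z2 by rewrite /Z2 !mulr_ge0 ?invr_ge0 ?powR_ge0.
have m0R : 0 < m0%:R :> R by rewrite ltr0n.
have lnq : 0 <= ln (m%:R / m0%:R) :> R.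
  by rewrite ln_ge0 // ler_pdivlMr // mul1r ler_nat ltnW.
have ln2 : 0 < ln 2 :> R by rewrite ln_gt0 // ltr1n.
have L0 : 0 <= L by rewrite divr_ge0 ?powR_ge0.
have n1R : 1 <= n0%:R :> R by rewrite ler1n.
have be0 : 0 <= alpha0 `^ p^-1 by exact: powR_ge0.
have := le_chaining_constant p2 (ltW b0) n1R be0 (ltW M0) Z10 Z20 L0.
have -> : (b * n0%:R + b ^+ 2 * alpha0 `^ p^-1 + ln (m%:R / m0%:R) / (2 ^+ n0 * alpha0) `^ p^-1) * M +
   H * ((m0%:R `^ (p0 / p) * DG `^ p0 + Ga) * (b `^ (p0 - 1))^-1) =
   (b * n0%:R + b ^+ 2 * alpha0 `^ p^-1 + L) * M + (Z1 + Z2) by rewrite /L /Z1 /Z2; ring.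
apply: le_trans; apply: lerD.
  apply: ler_wpM2l.
    by rewrite addr_ge0 // invr_ge0 subr_ge0 ltW // powR2_inv_gt1.
  have -> : 2 `^ (K0%:R / p) = (2 ^+ K0) `^ p^-1 :> R by rewrite powRrM powR_mulrn.
  by rewrite /D mulrC divfK // gt_eqF // powR_gt0.
rewrite ler_pM2l // /B; apply: lerD; first apply: lerD => //.
  rewrite ler_pM2l; last by rewrite !mulr_gt0.
  rewrite lerD2r ler_pM2r // natrD lerD2l; apply: le_trans Jle _.
  rewrite lerD2r ler_pM2l // ler_pM2l // ge0_ler_powR ?nnegrE ?(ltW al0) ?(ltW a0) //.
  by rewrite invr_ge0 ltW.
have inv_al : (al * 2 ^+ n0) `^ p^-1 != 0.
  by rewrite gt_eqF // powR_gt0 // mulr_gt0 // exprn_gt0.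
have n00 : 0 < 2 ^+ n0 :> R by rewrite exprn_gt0.
(* Returning from [al] to [alpha0] costs (24 * 2^p)^(1/p) = 2 * 24^(1/p) <= 48. *)
have h48 : (2 ^+ n0 * alpha0) `^ p^-1 <= 48 * (al * 2 ^+ n0) `^ p^-1.
  have -> : 2 ^+ n0 * alpha0 = (24 * 2 `^ p) * (al * 2 ^+ n0).
    by rewrite /al; field; rewrite gt_eqF.
  have c0 : 0 <= 24 * 2 `^ p :> R by rewrite mulr_ge0 // ltW.
  have an0 : 0 <= al * 2 ^+ n0 by rewrite mulr_ge0 // ltW.
  rewrite (powRM _ c0 an0); apply: ler_wpM2r; first exact: powR_ge0.
  rewrite (powRM _ _ (ltW tp0)) // -powRrM mulfV ?gt_eqF // powRr1 //.
  have : 24 `^ p^-1 <= 24 :> R; last by lra.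
  by rewrite -[leRHS](@powRr1 R 24) // ler_powR ?ler1n // invf_le1.
have pa : 0 < (al * 2 ^+ n0) `^ p^-1 by rewrite powR_gt0 // mulr_gt0.
have pb : 0 < (2 ^+ n0 * alpha0) `^ p^-1 by rewrite powR_gt0 // mulr_gt0.
have cnt := middle_level_count R m01 m0m K0lo; rewrite -/K1 in cnt.
have cnt' : (K1 - K0)%:R <= ln (m%:R / m0%:R) / ln 2 :> R by rewrite ler_pdivlMr.
have hinv : ((al * 2 ^+ n0) `^ p^-1)^-1 <= 48 * ((2 ^+ n0 * alpha0) `^ p^-1)^-1.
  have h := h48; rewrite -(ler_pdivrMr _ _ pa) in h.
  rewrite -(ler_pM2l pb); apply: le_trans h _.
  by rewrite mulrCA mulfV ?mulr1 // gt_eqF.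
apply: le_trans (_ : ln (m%:R / m0%:R) / ln 2 *
    (8 * (M * (48 * ((2 ^+ n0 * alpha0) `^ p^-1)^-1))) <= _).
  rewrite ler_pM ?ler0n ?mulr_ge0 ?invr_ge0 ?(ltW pa) ?(ltW M0) //.
  by rewrite ler_pM2l // ler_pM2l.
by rewrite /L le_eqVlt; apply/orP; left; apply/eqP; ring.
Qed.

(** * The theorem *)

Lemma gamma_eq0_of_dist0 (R : realType) (X : Type) (T : set X) (d : X -> X -> R)
    (p : R) : 1 <= p -> T !=set0 -> (forall x y, T x -> T y -> d x y = 0) ->
  (gamma p 1 T d <= 0)%E.
Proof.
move=> p1 T0 d0.
have := @gamma_le_contraction R X T d p 0 0 0 (fun _ _ => 0) p1 T0.
rewrite !mulr0 addr0; apply.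
- by move=> x y Tx Ty; rewrite d0 // lexx.
- move=> k A D' _ AT hD'; apply: splits1; first by rewrite expn_gt0.
  move=> x y Ax Ay; split; last by rewrite /= ?mulr0.
  rewrite /= ?addr0; have := hD' x y Ax Ay; rewrite d0; [|exact: AT|exact: AT].
  by move=> D0; rewrite divr_ge0.
- by move=> x n _; rewrite big1 // => k _; exact: mulr0.
Qed.

Section GammaPower.
Variables (R : realType) (X : Type) (alpha beta : R) (T : set X) (d : X -> X -> R).

Definition chain_sum (A : nat -> set (set X)) (x : X) : \bar R :=
  (\sum_(0 <= n <oo)
    ((2 `^ (n%:R / alpha))%R%:E * diam (pblock (A n) id x) d) `^ beta)%E.

(** Undoing the outer root exposes the infimum, so that a nearly optimal admissible sequence can be
    selected. *)
Lemma gamma_pow : 0 < beta -> T !=set0 ->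
  (gamma alpha beta T d `^ beta =
  ereal_inf [set ereal_sup [set chain_sum A x | x in T] | A in admissible T])%E.
Proof.
move=> beta0 [x0 Tx0]; rewrite /gamma -poweRrM mulVf ?gt_eqF // poweRe1 //.
apply: le_ereal_inf_tmp => _ [A _ <-]; apply: le_ereal_sup_tmp.
exists (chain_sum A x0); first by exists x0.
by apply: nneseries_ge0 => n _ _; exact: poweR_ge0.
Qed.

End GammaPower.

Lemma modulus_gt0_exists (R : realType) (m : nat) (p : R) (x : 'rV[R[i]]_m) :
  0 < p -> 0 < \sum_j modulus x j `^ p -> 0 < lnorm +oo x.
Proof.
move=> p0; apply: contraPT; rewrite -leNgt => h; apply/negP; rewrite -leNgt.
rewrite big1 // => j _.
have -> : modulus x j = 0.
  by apply/eqP; rewrite eq_le normc_ge0 (le_trans (modulus_le_lnormy x j)).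
by rewrite powR0 // gt_eqF.
Qed.

Lemma chaining_constant_gt0 (R : realType) (p : R) : 1 <= p ->
  0 < chaining_constant p.
Proof.
move=> p1; have pp : 0 < p by lra.
have u1 : 0 < 2 `^ p^-1 - 1 :> R by rewrite subr_gt0 powR2_inv_gt1.
have l0 : 0 <= (ln 2)^-1 :> R by rewrite invr_ge0 ln_ge0 // ler1n.
have w0 : 0 < 1 + 2 `^ p :> R by rewrite ltr_pwDl // powR_ge0.
have w1 : 0 < (2 `^ p^-1 - 1)^-1 + 2 :> R by rewrite ltr_wpDl // invr_ge0 ltW.
have [h _ _ _ _] := le_weighted_sum5 (mulr_ge0 (ltW w1) (ltW pp)) (ltW pp)
  (exprn_ge0 2 (ltW pp)) (mulr_ge0 (ltW pp) (ltW w0)) l0.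
apply: lt_le_trans h; apply: ltr_wpDl; last by rewrite mulr_gt0.
by apply: mulr_ge0 => //; apply: mulr_ge0; exact: ltW.
Qed.

Unset Implicit Arguments.
Local Open Scope ereal_scope.

Theorem theorem3p2 (R : realType) (p : R) (hp : (2 <= p)%R) :
  exists2 C : R, (0 < C)%R &
    forall p0 : R, (1 < p0)%R -> (p0 <= p)%R ->
    forall (m : nat) (G : set 'rV[R[i]]_m), G !=set0 ->
    forall (b alpha0 : R) (n0 m0 : nat),
      (0 < b)%R -> (0 < alpha0)%R -> (alpha0 < 1)%R ->
      (1 <= n0)%N -> (1 <= m0)%N -> (m0 < m)%N ->
    let p' := conjugate_exponent p in
    let p1 := exponent_p1 p p0 in
    gamma p 1%R (Tp p G) (ldist p'%:E) <=
    C%:E *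
      ((b * n0%:R + b ^+ 2 * alpha0 `^ p^-1
          + ln (m%:R / m0%:R) / (2 ^+ n0 * alpha0) `^ p^-1)%R%:E
         * ereal_sup [set (lnorm p%:E x `^ p)%R%:E | x in G]
       + ereal_sup [set (lnorm +oo x `^ (p - p0))%R%:E | x in G]
         * (((m0%:R `^ (p0 / p))%R%:E * diam G (ldist p1) `^ p0
              + gamma p p0 G (ldist p1) `^ p0)
            * ((b `^ (p0 - 1))^-1)%R%:E)).
Proof.
have hp1 : (1 <= p)%R by lra.
have pp : (0 < p)%R by lra.
have C0 := chaining_constant_gt0 hp1.
exists (chaining_constant p) => //.
move=> p0 p01 p0p m G G0 b al n0 m0 b0 a0 a1 n01 m01 m0m; cbv zeta.
set p' := conjugate_exponent p; set p1 := exponent_p1 p p0.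
have p0pos : (0 < p0)%R by lra.
have [x0 Gx0] := G0.
set C := chaining_constant p in C0 *.
set X := (b * n0%:R + _ + _)%R.
set SM := ereal_sup _; set SH := ereal_sup _.
set Z := (m0%:R `^ (p0 / p))%R; set DG := diam G _; set Ga := gamma p p0 G _ `^ p0.
set V := ((b `^ (p0 - 1))^-1)%R.
have m0R : (0 < m0%:R :> R)%R by rewrite ltr0n.
have X0 : (0 < X)%R.
  rewrite ltr_pwDl ?divr_ge0 ?powR_ge0 //; last first.
    by rewrite ln_ge0 // ler_pdivlMr // mul1r ler_nat ltnW.
  by rewrite ltr_pwDl ?mulr_ge0 ?powR_ge0 ?exprn_ge0 ?(ltW b0) // mulr_gt0 // ltr0n.
have Z0 : (0 < Z)%R by rewrite powR_gt0.
have V0 : (0 < V)%R by rewrite invr_gt0 powR_gt0.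
have SM0 : 0 <= SM.
  by apply: le_ereal_sup_tmp; exists (lnorm p%:E x0 `^ p)%:E; [exists x0 | rewrite lee_fin powR_ge0].
have SH0 : 0 <= SH.
  by apply: le_ereal_sup_tmp; exists (lnorm +oo x0 `^ (p - p0))%:E; [exists x0 | rewrite lee_fin powR_ge0].
have DG0 : 0 <= DG `^ p0 by exact: poweR_ge0.
have Ga0 : 0 <= Ga by exact: poweR_ge0.
have W0 : 0 <= Z%:E * DG `^ p0 + Ga.
  by rewrite adde_ge0 // mule_ge0 // lee_fin ltW.
have T0 : 0 <= SH * ((Z%:E * DG `^ p0 + Ga) * V%:E).
  by rewrite mule_ge0 // mule_ge0 // lee_fin ltW.
have XM0 : 0 <= X%:E * SM by rewrite mule_ge0 // lee_fin ltW.
have Tp0 : Tp p G !=set0 by eexists; exists x0.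
(* Infinite suprema are disposed of one at a time; here the right-hand side is +oo because X > 0. *)
have [SMy|SMfin] := eqVneq SM +oo.
  rewrite SMy gt0_muley ?lte_fin // addye ?gt0_muley ?lte_fin ?leey //.
  by rewrite gt_eqF // (lt_le_trans (ltNyr 0%R)).
have {SMfin} [M SME] : exists M, SM = M%:E.
  by exists (fine SM); rewrite fineK // ge0_fin_numE // lt_neqAle SMfin leey.
have GM x : G x -> (lnorm p%:E x `^ p <= M)%R.
  by move=> Gx; rewrite -lee_fin -SME; apply: ereal_sup_ubound; exists x.
have M0 : (0 <= M)%R by rewrite -lee_fin -SME.
(* If M = 0 then G consists of the zero vector only and the left-hand side vanishes; the levels of
   the main argument require M > 0. *)
have [Me|Mn] := eqVneq M 0%R.
  apply: le_trans (gamma_eq0_of_dist0 hp1 Tp0 _) _; last first.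
    by rewrite mule_ge0 ?adde_ge0 // lee_fin ltW.
  have mod0 x j : G x -> modulus x j = 0%R.
    move=> Gx; apply: (@powR_eq0_eq0 _ _ p); apply/eqP.
    have := GM x Gx; rewrite Me lnorm_pow // => h.
    rewrite eq_le powR_ge0 andbT; apply: le_trans h.
    by rewrite (bigD1 j) //= lerDl sumr_ge0 // => i _; exact: powR_ge0.
  move=> _ _ [x Gx <-] [y Gy <-]; rewrite ldist_Tp /distq big1 ?powR0 //.
    rewrite invr_eq0 gt_eqF // /p' /conjugate_exponent divr_gt0 //; lra.
  move=> j _; rewrite !mod0 // subrr normr0 powR0 // gt_eqF //.
  by rewrite /p' /conjugate_exponent divr_gt0 //; lra.
have Mp : (0 < M)%R by rewrite lt_neqAle eq_sym Mn.
have [H SHE] : exists H, SH = H%:E.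
  exists (fine SH); rewrite fineK // ge0_fin_numE //.
  apply: le_lt_trans (ltry ((M `^ p^-1) `^ (p - p0))).
  apply: ge_ereal_sup => _ [x Gx <-]; rewrite lee_fin.
  rewrite ge0_ler_powR ?nnegrE ?subr_ge0 ?powR_ge0 ?lnorm_ge0 //.
  rewrite /lnorm; apply/bigmax_leP; split=> [|j _]; first exact: powR_ge0.
  have pV : (0 <= p^-1)%R by rewrite invr_ge0 ltW.
  have h : (modulus x j `^ p <= M)%R.
    apply: le_trans (GM x Gx); rewrite lnorm_pow // (bigD1 j) //= lerDl.
    by rewrite sumr_ge0 // => i _; exact: powR_ge0.
  have := ge0_ler_powR pV _ _ h; rewrite !nnegrE powR_ge0 M0 => /(_ isT isT).
  by rewrite -powRrM mulfV ?gt_eqF // powRr1 // normc_ge0.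
have GH x : G x -> (lnorm +oo x `^ (p - p0) <= H)%R.
  by move=> Gx; rewrite -lee_fin -SHE; apply: ereal_sup_ubound; exists x.
(* Since M > 0 some point of G is nonzero. Strict positivity makes H times +oo equal to +oo in the
   remaining infinite cases, and allows division by H below. *)
have H0 : (0 < H)%R.
  have [] := @ereal_sup_gt R [set (lnorm p%:E x `^ p)%R%:E | x in G] 0.
    by rewrite -/SM SME lte_fin.
  move=> _ [x Gx <-]; rewrite lte_fin lnorm_pow // => /(modulus_gt0_exists pp) h.
  by apply: lt_le_trans (GH x Gx); rewrite powR_gt0.
have topRHS : Z%:E * DG `^ p0 + Ga = +oo ->
    C%:E * (X%:E * SM + SH * ((Z%:E * DG `^ p0 + Ga) * V%:E)) = +oo.
  move=> ->; rewrite gt0_mulye ?lte_fin // SHE gt0_muley ?lte_fin //.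
  rewrite addey ?gt0_muley ?lte_fin //.
  by rewrite gt_eqF // (lt_le_trans (ltNyr 0%R)).
have [DGy|DGfin] := eqVneq DG +oo.
  rewrite topRHS ?leey // DGy poweRyr ?gt_eqF // gt0_muley ?lte_fin // addye //.
  by rewrite gt_eqF // (lt_le_trans (ltNyr 0%R)).
have DGge0 : 0 <= DG.
  apply: le_ereal_sup_tmp; exists (ldist p1 x0 x0)%:E; first by exists x0 => //; exists x0.
  by rewrite lee_fin lnorm_ge0.
have {DGfin} [D DE] : exists D, DG = D%:E.
  by exists (fine DG); rewrite fineK // ge0_fin_numE // lt_neqAle DGfin leey.
have GD x y : G x -> G y -> (ldist p1 x y <= D)%R.
  by move=> Gx Gy; rewrite -lee_fin -DE; apply: ereal_sup_ubound; exists x => //; exists y.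
have [Gay|Gafin] := eqVneq Ga +oo.
  rewrite topRHS ?leey // Gay addey //.
  by rewrite gt_eqF // (lt_le_trans (ltNyr 0%R)) // mule_ge0 // lee_fin ltW.
have {Gafin} [g GaE] : exists g, Ga = g%:E.
  by exists (fine Ga); rewrite fineK // ge0_fin_numE // lt_neqAle Gafin leey.
apply/lee_addgt0Pr => eps eps0.
(* The infimum need not be attained: a sequence within [e] of it is used, and [e] is scaled so that
   the excess on the right is exactly [eps]. *)
pose e := (eps / (C * (H * V)))%R.
have CHV : (0 < C * (H * V))%R by rewrite !mulr_gt0.
have e0 : (0 < e)%R by rewrite divr_gt0.
have infE := gamma_pow p (ldist p1) p0pos G0.
rewrite -/Ga GaE in infE.
have [] := @lb_ereal_inf_adherent R
  [set ereal_sup [set chain_sum p p0 (ldist p1) A x | x in G] | A in admissible G] e e0.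
  by rewrite -infE.
rewrite -infE -EFinD => _ [A admA <-] supA.
have hA x : G x -> chain_sum p p0 (ldist p1) A x <= (g + e)%:E.
  by move=> Gx; apply: le_trans (ltW supA); apply: ereal_sup_ubound; exists x.
apply: le_trans (gamma_Tp_le hp p01 p0p G0 b0 a0 a1 n01 m01 m0m Mp (ltW H0) GM GH GD admA hA) _.
rewrite SME SHE DE GaE poweR_EFin -!EFinM -!EFinD lee_fin -/X -/Z -/V -/C.
rewrite le_eqVlt; apply/orP; left; apply/eqP; rewrite /e.
by field; rewrite !gt_eqF.
Qed.
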